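(* There exists a constant $b$ such that for all $0<p=p(n)\le 1$ we have $q^*(G_{n,p})<\frac{b}{\sqrt{np}}$ whp. Also, given $0<\varepsilon<1$, there exists $a=a(\varepsilon)>0$ such that, if $p=p(n)$ satisfies $np\ge 1$ and $p\le 1-\varepsilon$ for all sufficiently large $n$, then $q^*(G_{n,p})>\frac{a}{\sqrt{np}}$ whp.
   Context: For a graph $G$ with $m\ge 1$ edges and a vertex partition $\mathcal A$, $q_{\mathcal A}(G)=\frac1m\sum_{A\in\mathcal A}e(A)-\frac{1}{4m^2}\sum_{A\in\mathcal A}\mathrm{vol}(A)^2$ ($e(A)$: number of edges within $A$; $\mathrm{vol}(A)$: sum of degrees in $A$); $q^*(G)=\max_{\mathcal A}q_{\mathcal A}(G)$, and $q^*(G)=0$ if $G$ has no edges. $G_{n,p}$ is the Erdős–Rényi random graph on $[n]$ with independent edge probability $p$; whp means with probability tending to $1$ as $n\to\infty$. *)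

(* Defs.v *)
From HB Require Import structures.
From mathcomp Require Import all_boot all_order all_algebra.
From mathcomp Require Import all_classical all_reals all_analysis.

Set Implicit Arguments.
Unset Strict Implicit.
Unset Printing Implicit Defensive.

Import Order.TTheory GRing.Theory Num.Theory.
Import numFieldNormedType.Exports.

Local Open Scope ring_scope.

Section Graphs.
Variable V : finType.

Definition vpairs : {set {set V}} := [set e : {set V} | #|e| == 2%N]%SET.

Record sgraph := SGraph {
  edges : {set {set V}};
  _ : edges \subset vpairs }.

HB.instance Definition _ := [isSub for edges].
HB.instance Definition _ := [Countable of sgraph by <:].
HB.instance Definition _ := [Finite of sgraph by <:].

Definition num_edges (G : sgraph) : nat := #|edges G|.

Definition edges_within (G : sgraph) (A : {set V}) : nat :=
  #|[pred e in edges G | e \subset A]|.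

Definition degree (G : sgraph) (v : V) : nat := #|[pred e in edges G | v \in e]|.

Definition vol (G : sgraph) (A : {set V}) : nat := (\sum_(v in A) degree G v)%N.

Variable R : realType.

Definition modularity_score (G : sgraph) (P : {set {set V}}) : R :=
  let m : R := (num_edges G)%:R in
  m^-1 * (\sum_(A in P) (edges_within G A)%:R)
  - (4 * m ^+ 2)^-1 * (\sum_(A in P) (vol G A)%:R ^+ 2).

(* The default value of the maximum is the score of the one-part partition,
   which is a vertex partition since a graph with an edge has a vertex. *)
Definition modularity (G : sgraph) : R :=
  if num_edges G == 0%N then 0
  else \big[Num.max/modularity_score G [set [set: V]]%SET]_
         (P : {set {set V}} | finset.partition P [set: V]%SET) modularity_score G P.

End Graphs.

Definition gnp_weight (R : realType) (n : nat) (p : R) (G : sgraph 'I_n) : R :=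
  \prod_(e in vpairs 'I_n) (if e \in edges G then p else 1 - p).

Definition gnp_prob (R : realType) (n : nat) (p : R)
    (A : pred (sgraph 'I_n)) : R :=
  \sum_(G : sgraph 'I_n | A G) gnp_weight p G.

Definition gnp_whp (R : realType) (p : nat -> R)
    (A : forall n, pred (sgraph 'I_n)) : Prop :=
  ((fun n => gnp_prob (p n) (A n)) @ \oo --> (1 : R))%classic.

(* Main.v *)
(** Upper bound: giving each part of a vertex partition an independent fair sign
    produces a bipartition S, T whose score is on average half that of the
    partition, and the score of S, T is (4 e(S) e(T) - e(S,T)^2) / (2 m^2). The
    number of edges inside each of the 2^n vertex sets S is within 3 n sqrt(np) of
    its mean except with probability exponentially small in n (Chernoff), and the
    means almost cancel in that formula. If np is bounded, q* <= 1 suffices.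

    Lower bound: fix two disjoint sets U+, U- of n/4 vertices and let each other
    vertex w join the set in which it has more neighbours; ties get the value 0,
    and such fractional assignments are rounded at random. The gain is the sum of
    the |D_w|, D_w being the difference of the two degrees of w, and
    E|D_w| >= c sqrt(np) follows from the second and fourth moments of D_w. The
    other contributions are of smaller order by second moment estimates; for the
    difference of the volumes of the two sides, the contributions of distinct
    w, w' are orthogonal because exchanging U+ and U- in the edges at w changes
    the side of w but neither its degree nor the side of w'. *)

Require Import Defs.
From mathcomp Require Import all_boot all_order all_algebra.
From mathcomp Require Import all_classical all_reals all_analysis.
From mathcomp Require Import ring lra zify fintype finset.

Set Implicit Arguments.
Unset Strict Implicit.
Unset Printing Implicit Defensive.

Import Order.TTheory GRing.Theory Num.Theory.
Import numFieldNormedType.Exports.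

Local Open Scope ring_scope.

(** * Expectations over a random subset with independent memberships *)

Section BernoulliSubset.
Variables (R : realFieldType) (I : finType) (P : I -> R).
Implicit Types (J K F : {set I}) (f g : {set I} -> R) (B : pred {set I}).

(** Probability of [J] under the product measure. Expectations are finite weighted sums over
    subsets, so the probability theory becomes algebra of finite sums. *)
Definition bweight J : R := \prod_i (if i \in J then P i else 1 - P i).

Definition Ex f : R := \sum_(J : {set I}) bweight J * f J.

Definition Pr B : R := Ex (fun J => (B J)%:R).

(** Measurability with respect to the coordinates in [F], the form in which independence is used. *)
Definition dep_on F f := forall J K, J :&: F = K :&: F -> f J = f K.

Definition centered i J : R := (i \in J)%:R - P i.

Lemma eq_Ex f g : f =1 g -> Ex f = Ex g.
Proof. by move=> fg; apply: eq_bigr => J _; rewrite fg. Qed.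

Lemma ExD f g : Ex (fun J => f J + g J) = Ex f + Ex g.
Proof. by rewrite /Ex -big_split; apply: eq_bigr => J _; rewrite mulrDr. Qed.

Lemma ExZ a f : Ex (fun J => a * f J) = a * Ex f.
Proof. by rewrite /Ex mulr_sumr; apply: eq_bigr => J _; rewrite mulrCA. Qed.

Lemma ExN f : Ex (fun J => - f J) = - Ex f.
Proof. by rewrite /Ex -sumrN; apply: eq_bigr => J _; rewrite mulrN. Qed.

Lemma ExB f g : Ex (fun J => f J - g J) = Ex f - Ex g.
Proof. by rewrite ExD ExN. Qed.

Lemma Ex_sum (T : Type) (s : seq T) (Q : pred T) (h : T -> {set I} -> R) :
  Ex (fun J => \sum_(x <- s | Q x) h x J) = \sum_(x <- s | Q x) Ex (h x).
Proof. by rewrite /Ex exchange_big; apply: eq_bigr => J _; rewrite mulr_sumr. Qed.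

Lemma Ex_prod (a b : I -> R) :
  Ex (fun J => \prod_i (if i \in J then a i else b i)) =
  \prod_i (P i * a i + (1 - P i) * b i).
Proof.
rewrite bigA_distr; apply: eq_bigr => J _.
by rewrite -big_split; apply: eq_bigr => i _; case: ifP.
Qed.

Lemma sum_bweight : \sum_(J : {set I}) bweight J = 1.
Proof.
rewrite /bweight -(bigA_distr 1 +%R P (fun i => 1 - P i)) big1 // => i _.
by rewrite /=; ring.
Qed.

Lemma Ex_cst a : Ex (fun=> a) = a.
Proof. by rewrite /Ex -mulr_suml sum_bweight mul1r. Qed.

Lemma Ex_mem i (h : bool -> R) :
  Ex (fun J => h (i \in J)) = P i * h true + (1 - P i) * h false.
Proof.
(* The function is written as a product over all coordinates in which only the factor at [i] differs
   from 1. *)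
rewrite -(eq_Ex (f := fun J => \prod_j (if j \in J
    then (if j == i then h true else 1) else (if j == i then h false else 1)))).
  rewrite Ex_prod (bigD1 i) //= eqxx big1 ?mulr1 // => j /negPf ->.
  by rewrite !mulr1; ring.
move=> J; rewrite (bigD1 i) //= eqxx big1 ?mulr1; first by case: (i \in J).
by move=> j /negPf ->; case: ifP.
Qed.

(* Exchanging the parts of J and K outside F preserves the product weight. *)
Lemma Ex_indep F f g : dep_on F f -> dep_on (~: F) g ->
  Ex (fun J => f J * g J) = Ex f * Ex g.
Proof.
move=> hf hg.
pose h (x : {set I} * {set I}) :=
  ((x.1 :&: F) :|: (x.2 :&: ~: F), (x.2 :&: F) :|: (x.1 :&: ~: F)).
have hK : involutive h.
  case=> J K; congr pair; apply/setP => i; rewrite !inE /=;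
  by case: (i \in F); rewrite ?andbF ?andbT ?orbF.
have -> : Ex f * Ex g =
    \sum_(x : {set I} * {set I}) bweight x.1 * bweight x.2 * (f x.1 * g x.2).
  rewrite /Ex mulr_suml -(pair_big xpredT xpredT
    (fun J K => bweight J * bweight K * (f J * g K))) /=.
  by apply: eq_bigr => J _; rewrite mulr_sumr; apply: eq_bigr => K _; rewrite mulrACA.
rewrite (reindex_inj (inv_inj hK)) /=.
rewrite -(pair_big xpredT xpredT (fun J K => bweight (h (J, K)).1 *
  bweight (h (J, K)).2 * (f (h (J, K)).1 * g (h (J, K)).2))) /=.
apply: eq_bigr => J _.
transitivity (\sum_K bweight K * (bweight J * (f J * g J))).
  by rewrite -mulr_suml sum_bweight mul1r.
apply: eq_bigr => K _; rewrite mulrA; congr (_ * (_ * _)).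
- rewrite /bweight -!big_split; apply: eq_bigr => i _ /=; rewrite !inE.
  by case: (i \in F); rewrite ?andbF ?andbT ?orbF //= mulrC.
- apply: hf; apply/setP => i; rewrite !inE.
  by case: (i \in F); rewrite ?andbF ?andbT ?orbF.
- apply: hg; apply/setP => i; rewrite !inE.
  by case: (i \in F); rewrite ?andbF ?andbT ?orbF.
Qed.

(** A relabelling of coordinates that respects their probabilities preserves the product measure;
    this supports the symmetry argument for volumes. *)
Lemma Ex_preim (phi : I -> I) f : involutive phi -> (forall i, P (phi i) = P i) ->
  Ex (fun J => f (phi @^-1: J)) = Ex f.
Proof.
move=> phiK Pphi.
have hK : involutive (fun J : {set I} => phi @^-1: J).
  by move=> J; apply/setP => i; rewrite !inE phiK.
rewrite /Ex [RHS](reindex_inj (inv_inj hK)); apply: eq_bigr => J _; congr (_ * _).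
rewrite /bweight [LHS](reindex_inj (inv_inj phiK)); apply: eq_bigr => i _.
by rewrite inE Pphi.
Qed.

Lemma dep_on_mem F i (h : bool -> R) : i \in F -> dep_on F (fun J => h (i \in J)).
Proof. by move=> iF J K /setP/(_ i); rewrite !inE iF !andbT => ->. Qed.

Lemma Ex_centered i : Ex (centered i) = 0.
Proof. by rewrite (Ex_mem i (fun b => b%:R - P i)) /=; ring. Qed.

Lemma Ex_centered_sqr i : Ex (fun J => centered i J ^+ 2) = P i * (1 - P i).
Proof. by rewrite (Ex_mem i (fun b => (b%:R - P i) ^+ 2)) /=; ring. Qed.

(** The main source of orthogonality: a centered coordinate averages to 0 against anything that does
    not depend on it. *)
Lemma Ex_centered_mul0 i g : dep_on (~: [set i]%SET) g ->
  Ex (fun J => centered i J * g J) = 0.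
Proof.
move=> hg; rewrite (Ex_indep _ hg) ?Ex_centered ?mul0r //.
by apply: (dep_on_mem (fun b => b%:R - P i)); rewrite inE.
Qed.

(** Pythagoras: the cross terms of the expanded square vanish. *)
Lemma Ex_sqr_orthogonal (T : finType) (Q : pred T) (h : T -> {set I} -> R) :
  (forall x y, Q x -> Q y -> x != y -> Ex (fun J => h x J * h y J) = 0) ->
  Ex (fun J => (\sum_(x | Q x) h x J) ^+ 2) =
  \sum_(x | Q x) Ex (fun J => h x J ^+ 2).
Proof.
move=> orth.
rewrite (eq_Ex (g := fun J => \sum_(x | Q x) \sum_(y | Q y) h x J * h y J)); last first.
  by move=> J; rewrite expr2 mulr_suml; apply: eq_bigr => x _; rewrite mulr_sumr.
rewrite Ex_sum; apply: eq_bigr => x Qx; rewrite Ex_sum (bigD1 x) //=.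
rewrite big1 ?addr0 => [|y /andP[Qy yx]]; last by rewrite orth // eq_sym.
by apply: eq_Ex => J; rewrite expr2.
Qed.

(** * Monotonicity, union bounds, Markov and Chebyshev inequalities *)

Hypothesis P01 : forall i, 0 <= P i <= 1.

Lemma bweight_ge0 J : 0 <= bweight J.
Proof.
apply: prodr_ge0 => i _; case/andP: (P01 i) => ? ?.
by case: ifP => _ //; rewrite subr_ge0.
Qed.

Lemma le_Ex f g : (forall J, f J <= g J) -> Ex f <= Ex g.
Proof. by move=> fg; apply: ler_sum => J _; rewrite ler_wpM2l ?bweight_ge0. Qed.

Lemma Ex_ge0 f : (forall J, 0 <= f J) -> 0 <= Ex f.
Proof. by move=> f0; rewrite -[X in X <= _](Ex_cst 0); apply: le_Ex. Qed.

Lemma Pr_sub B B' : {subset B <= B'} -> Pr B <= Pr B'.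
Proof.
move=> BB'; apply: le_Ex => J; rewrite ler_nat.
by have := BB' J; rewrite !unfold_in; case: (B J) => // ->.
Qed.

Lemma PrC B : Pr (fun J => ~~ B J) = 1 - Pr B.
Proof.
rewrite -[1](Ex_cst 1) -ExB; apply: eq_Ex => J.
by case: (B J); rewrite ?subr0 ?subrr.
Qed.

Lemma PrU B B' : Pr (fun J => B J || B' J) <= Pr B + Pr B'.
Proof. by rewrite -ExD; apply: le_Ex => J; rewrite -natrD ler_nat; case: (B J); case: (B' J). Qed.

Lemma Pr_exists (T : finType) (B : T -> pred {set I}) :
  Pr (fun J => [exists x, B x J]) <= \sum_x Pr (B x).
Proof.
rewrite -Ex_sum; apply: le_Ex => J.
case: existsP => [[x Bx]|_]; last by rewrite sumr_ge0 // => x _; rewrite ler0n.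
by rewrite (bigD1 x) //= Bx lerDl sumr_ge0 // => y _; rewrite ler0n.
Qed.

Lemma Pr_markov B f t : 0 < t -> (forall J, 0 <= f J) -> (forall J, B J -> t <= f J) ->
  Pr B <= Ex f / t.
Proof.
move=> t0 f0 Bf; rewrite ler_pdivlMr // mulrC -ExZ; apply: le_Ex => J.
by case BJ: (B J); rewrite ?mulr1 ?mulr0 ?Bf.
Qed.

Lemma Pr_chebyshev B f t : 0 < t -> (forall J, B J -> t <= `|f J|) ->
  Pr B <= Ex (fun J => f J ^+ 2) / t ^+ 2.
Proof.
move=> t0 Bf; apply: Pr_markov => [|J|J /Bf tf]; rewrite ?exprn_gt0 ?sqr_ge0 //.
by rewrite -(real_normK (num_real (f J))) lerXn2r ?nnegrE // ltW.
Qed.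

(** First moment method: it turns random sign choices into an actual bipartition. *)
Lemma Ex_le_exists f : exists J, Ex f <= f J.
Proof.
case: (arg_maxP f (i0 := set0) (P := xpredT)) => // J _ Jmax.
by exists J; rewrite -[leRHS]Ex_cst; apply: le_Ex => K; apply: Jmax.
Qed.

(** The fourth moment is exactly [v (1 - 3 v)] with [v = P i * (1 - P i)]. *)
Lemma Ex_centered_exp4 i : Ex (fun J => centered i J ^+ 4) <= P i * (1 - P i).
Proof.
rewrite (Ex_mem i (fun b => (b%:R - P i) ^+ 4)) /=; case/andP: (P01 i) => p0 p1.
have -> : P i * (1 - P i) ^+ 4 + (1 - P i) * (0 - P i) ^+ 4 =
  P i * (1 - P i) * ((1 - P i) ^+ 3 + P i ^+ 3) by ring.
have v0 : 0 <= P i * (1 - P i) by rewrite mulr_ge0 // subr_ge0.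
rewrite -[leRHS]mulr1 ler_wpM2l //.
have -> : (1 - P i) ^+ 3 + P i ^+ 3 = 1 - 3 * (P i * (1 - P i)) by ring.
lra.
Qed.

(** * Second and fourth moments of linear forms in centered indicators *)

Section LinearForm.
Variables (T : eqType) (c : T -> R) (e : T -> I).

Definition linform (s : seq T) J := \sum_(x <- s) c x * centered (e x) J.

Lemma dep_on_linform s F : (forall x, x \in s -> e x \in F) -> dep_on F (linform s).
Proof.
move=> sF J K JK; apply: eq_big_seq => x /sF exF; congr (_ * _).
exact: (dep_on_mem (fun b => b%:R - P (e x)) exF JK).
Qed.

Lemma linform_step x s J : linform (x :: s) J = c x * centered (e x) J + linform s J.
Proof. by rewrite /linform big_cons. Qed.

Lemma Ex_linform_mul x s (h k : R -> R) : e x \notin map e s ->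
  Ex (fun J => h (centered (e x) J) * k (linform s J)) =
  Ex (fun J => h (centered (e x) J)) * Ex (fun J => k (linform s J)).
Proof.
move=> xs; apply: (@Ex_indep [set e x]%SET).
  by apply: (dep_on_mem (fun b => h (b%:R - P (e x)))); rewrite inE.
move=> J K JK; congr k; apply: dep_on_linform JK => y ys; rewrite !inE.
by apply: contraNneq xs => <-; apply: map_f.
Qed.

Lemma Ex_linform s : Ex (linform s) = 0.
Proof. by rewrite /linform Ex_sum big1 // => x _; rewrite ExZ Ex_centered mulr0. Qed.

Lemma Ex_linform_sqr s : uniq (map e s) ->
  Ex (fun J => linform s J ^+ 2) = \sum_(x <- s) c x ^+ 2 * (P (e x) * (1 - P (e x))).
Proof.
elim: s => [|x s IH] /=.
  move=> _; rewrite big_nil -[RHS]Ex_cst; apply: eq_Ex => J.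
  by rewrite /linform big_nil expr0n.
case/andP => xs /IH {}IH; rewrite big_cons -IH -Ex_centered_sqr.
have mean0 : Ex (fun J => centered (e x) J * linform s J) = 0.
  by rewrite (Ex_linform_mul id id) // Ex_centered mul0r.
transitivity (Ex (fun J => c x ^+ 2 * centered (e x) J ^+ 2 + linform s J ^+ 2 +
    2 * c x * (centered (e x) J * linform s J))).
  by apply: eq_Ex => J; rewrite linform_step; ring.
by rewrite !ExD !ExZ mean0 mulr0 addr0.
Qed.

(** Induction on the number of terms. In the expanded fourth power both odd mixed terms have mean 0,
    the middle term [6 c^2 v q] is the cross term of [3 (c^2 v + q)^2], and the fourth moment of the
    new term is at most [c^2 v]. *)
Lemma Ex_linform_exp4 s : uniq (map e s) -> (forall x, x \in s -> c x ^+ 2 <= 1) ->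
  Ex (fun J => linform s J ^+ 4) <=
  3 * Ex (fun J => linform s J ^+ 2) ^+ 2 + Ex (fun J => linform s J ^+ 2).
Proof.
elim: s => [|x s IH] /=.
  move=> _ _; rewrite (eq_Ex (g := fun=> 0)) ?Ex_cst; last first.
    by move=> J; rewrite /linform big_nil expr0n.
  have h0 : 0 <= Ex (fun J => linform [::] J ^+ 2) by apply: Ex_ge0 => J; rewrite sqr_ge0.
  by rewrite addr_ge0 // mulr_ge0 // sqr_ge0.
move=> u c1; rewrite (Ex_linform_sqr (s := x :: s)) // big_cons.
case/andP: u => xs us; rewrite -(Ex_linform_sqr us).
have {}IH := IH us (fun y ys => c1 y (mem_behead (s := x :: s) ys)).
have cx1 : c x ^+ 2 <= 1 by apply: c1; rewrite mem_head.
set v := P (e x) * _; set q := Ex (fun J => linform s J ^+ 2) in IH *.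
have v0 : 0 <= v by rewrite mulr_ge0 // ?subr_ge0; case/andP: (P01 (e x)).
have q0 : 0 <= q by apply: Ex_ge0 => J; rewrite sqr_ge0.
have c0 : 0 <= c x ^+ 2 by rewrite sqr_ge0.
have -> : Ex (fun J => linform (x :: s) J ^+ 4) =
    c x ^+ 4 * Ex (fun J => centered (e x) J ^+ 4) + 6 * c x ^+ 2 * (v * q) +
    Ex (fun J => linform s J ^+ 4).
  transitivity (c x ^+ 4 * Ex (fun J => centered (e x) J ^+ 4) +
    6 * c x ^+ 2 * Ex (fun J => centered (e x) J ^+ 2 * linform s J ^+ 2) +
    Ex (fun J => linform s J ^+ 4) +
    4 * c x ^+ 3 * Ex (fun J => centered (e x) J ^+ 3 * linform s J) +
    4 * c x * Ex (fun J => centered (e x) J * linform s J ^+ 3)).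
    by rewrite -!ExZ -!ExD; apply: eq_Ex => J; rewrite linform_step; ring.
  rewrite (Ex_linform_mul (fun y => y ^+ 3) id) // Ex_linform mulr0.
  rewrite (Ex_linform_mul id (fun y => y ^+ 3)) // Ex_centered mul0r.
  rewrite (Ex_linform_mul (fun y => y ^+ 2) (fun y => y ^+ 2)) //.
  by rewrite Ex_centered_sqr -/v -/q; ring.
have m4 : c x ^+ 4 * Ex (fun J => centered (e x) J ^+ 4) <= c x ^+ 2 * v.
  have -> : c x ^+ 4 = c x ^+ 2 * c x ^+ 2 by ring.
  rewrite -mulrA ler_wpM2l //.
  apply: le_trans (ler_wpM2l c0 (Ex_centered_exp4 (e x))) _.
  by rewrite -/v -[leRHS]mul1r ler_wpM2r.
have : 0 <= (c x ^+ 2 * v) ^+ 2 by rewrite sqr_ge0.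
nra.
Qed.

End LinearForm.

(** In the variable [y = |x| / t] this is [y^2 - y^4 <= y]: for [y <= 1] already [y^2 <= y], and for
    [y >= 1] the left side is nonpositive. It bounds a first absolute moment below by even
    moments. *)
Lemma abs_poly_ge (x t : R) : 0 < t -> x ^+ 2 / t - x ^+ 4 / t ^+ 3 <= `|x|.
Proof.
move=> t0; set y := `|x| / t.
have y0 : 0 <= y by rewrite divr_ge0 // ltW.
have tn : t != 0 by rewrite gt_eqF.
have -> : `|x| = t * y by rewrite /y mulrCA divff // mulr1.
have x2 : x ^+ 2 = t ^+ 2 * y ^+ 2.
  by rewrite -(real_normK (num_real x)) /y; field.
have -> : x ^+ 4 = (x ^+ 2) ^+ 2 by rewrite -exprM.
rewrite x2.
have -> : t ^+ 2 * y ^+ 2 / t - (t ^+ 2 * y ^+ 2) ^+ 2 / t ^+ 3 = t * (y ^+ 2 - y ^+ 4).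
  by field.
rewrite ler_pM2l //.
have [y1|y1] := leP y 1; first by have : 0 <= y ^+ 4; [rewrite exprn_ge0|nra].
have : 1 <= y ^+ 2 by nra.
have -> : y ^+ 4 = y ^+ 2 * y ^+ 2 by ring.
nra.
Qed.

(* Apply abs_poly_ge with t = 2 K q. *)
Lemma Ex_abs_ge f (q K : R) : 0 < q -> 1 <= K -> Ex (fun J => f J ^+ 2) = q ^+ 2 ->
  Ex (fun J => f J ^+ 4) <= K * q ^+ 4 -> q <= 4 * K * Ex (fun J => `|f J|).
Proof.
move=> q0 K1 m2 m4; have K0 : 0 < K by apply: lt_le_trans K1.
have t0 : 0 < 2 * K * q by rewrite !mulr_gt0.
have : Ex (fun J => f J ^+ 2) / (2 * K * q) - Ex (fun J => f J ^+ 4) / (2 * K * q) ^+ 3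
    <= Ex (fun J => `|f J|).
  rewrite !(mulrC (Ex _)) -!ExZ -ExB; apply: le_Ex => J.
  by rewrite !(mulrC _^-1); apply: abs_poly_ge.
(* The main term is [q / (2 K)] and the correction at most [q / (8 K)], which leaves more than
   [q / (4 K)]. *)
have m4' : Ex (fun J => f J ^+ 4) / (2 * K * q) ^+ 3 <= q / (8 * K).
  rewrite ler_pdivrMr ?exprn_gt0 //; apply: le_trans m4 _.
  have -> : q / (8 * K) * (2 * K * q) ^+ 3 = K ^+ 2 * q ^+ 4 by field; rewrite gt_eqF.
  by rewrite ler_pM2r ?exprn_gt0 // expr2 ler_peMl // ltW.
have -> : Ex (fun J => f J ^+ 2) / (2 * K * q) = q / (2 * K).
  by rewrite m2; field; rewrite !gt_eqF.
move=> h.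
have : q / (4 * K) <= Ex (fun J => `|f J|).
  have qK : 0 <= q / K by rewrite divr_ge0 // ltW.
  have e2 : q / (2 * K) = q / K / 2 by field; rewrite gt_eqF.
  have e4 : q / (4 * K) = q / K / 4 by field; rewrite gt_eqF.
  have e8 : q / (8 * K) = q / K / 8 by field; rewrite gt_eqF.
  lra.
by rewrite ler_pdivrMr ?mulr_gt0 // mulrC.
Qed.

End BernoulliSubset.

(** * The modularity matrix and its quadratic form *)

Section QuadraticForm.
Variables (R : realType) (V : finType).
Implicit Types (J : {set {set V}}) (S : {set V}) (s : V -> R) (G : sgraph V).

(** [J] is an arbitrary family of vertex sets, so that it can be a random subset; the test [u != v]
    keeps singletons in [J] from acting as loops. *)
Definition adj J (u v : V) : R := ((u != v) && ([set u; v]%SET \in J))%:R.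

Definition deg J (v : V) : R := \sum_u adj J u v.

Definition msize J : R := (\sum_u \sum_v adj J u v) / 2.

(** Newman's modularity matrix; [modform] is its quadratic form. *)
Definition modmx J (u v : V) : R := adj J u v - deg J u * deg J v / (2 * msize J).

Definition modform J s : R := \sum_u \sum_v modmx J u v * (s u * s v).

Definition spin S (v : V) : R := if v \in S then 1 else -1.

Lemma adjC J u v : adj J u v = adj J v u.
Proof. by rewrite /adj eq_sym setUC. Qed.

Lemma adj_diag J u : adj J u u = 0.
Proof. by rewrite /adj eqxx. Qed.

Lemma sum_deg J : \sum_v deg J v = 2 * msize J.
Proof. by rewrite /msize mulrC divfK ?pnatr_eq0 // exchange_big. Qed.

Lemma edge_card G e : e \in edges G -> #|e| = 2%N.
Proof. by case: G => E /= /subsetP EV /EV; rewrite inE => /eqP. Qed.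

Lemma adj_edges G u v :
  adj (edges G) u v = \sum_(e in edges G) ([&& u != v, u \in e & v \in e])%:R.
Proof.
rewrite /adj; have [-> /=|uv] := eqVneq u v; first by rewrite big1.
have eqe e : e \in edges G -> ((u \in e) && (v \in e)) = (e == [set u; v]%SET).
  move=> /edge_card e2; rewrite eq_sym eqEcard e2 cards2 uv leqnn andbT.
  by rewrite subUset !sub1set.
rewrite (eq_bigr (fun e => (e == [set u; v]%SET)%:R)); last first.
  by move=> e eG; rewrite -(eqe e eG).
have [uvG|uvG] := boolP (_ \in _).
  by rewrite (bigD1 [set u; v]%SET) //= eqxx big1 ?addr0 // => e /andP[_ /negPf ->].
by rewrite big1 // => e eG; rewrite (negPf (contraNneq _ uvG)) // => <-.
Qed.

Lemma sum_pairs_edge (e S : {set V}) : #|e| = 2%N -> e \subset S ->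
  \sum_(u in S) \sum_(v in S) ([&& u != v, u \in e & v \in e])%:R = 2 :> R.
Proof.
move=> e2 /subsetP eS.
transitivity (\sum_(u in e) (1 : R)); last by rewrite sumr_const e2.
rewrite (big_mkcond (mem S)) [RHS]big_mkcond; apply: eq_bigr => u _ /=.
case ue: (u \in e); last first.
  by case: (u \in S) => //; rewrite big1 // => v _; rewrite andbF.
rewrite eS //; have := cardsD1 u e; rewrite ue e2 => /eqP.
rewrite eqSS => /eqP e1.
transitivity (#|e :\ u|%:R : R); last by rewrite -e1.
rewrite -sum1_card natr_sum.
rewrite (big_mkcond (mem S)) [RHS]big_mkcond; apply: eq_bigr => v _ /=.
rewrite !inE (eq_sym u v); case: (v != u) => /=; last by case: ifP.
by case ve: (v \in e); [rewrite eS | case: ifP].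
Qed.

Lemma sum_adj_edges_within G S :
  \sum_(u in S) \sum_(v in S) adj (edges G) u v = 2 * (edges_within G S)%:R.
Proof.
under eq_bigr => u _ do (under eq_bigr => v _ do rewrite adj_edges).
under eq_bigr => u _ do rewrite exchange_big.
rewrite exchange_big /= (bigID (fun e : {set V} => e \subset S)) /=.
rewrite (eq_bigr (fun=> 2)) => [|e /andP[/edge_card e2 eS]]; last first.
  exact: sum_pairs_edge.
rewrite sumr_const mulr_natr [X in _ + X]big1 ?addr0 // => e /andP[/edge_card e2 eS].
rewrite big1 // => u uS; rewrite big1 // => v vS.
case: (boolP [&& _, _ & _]) => // /and3P[uv ue ve]; case/negP: eS.
have -> : e = [set u; v]%SET.
  apply/esym/eqP; rewrite eqEcard e2 cards2 uv leqnn andbT.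
  by rewrite subUset !sub1set ue.
by rewrite subUset !sub1set uS.
Qed.

Lemma deg_degree G v : deg (edges G) v = (degree G v)%:R.
Proof.
rewrite /deg; under eq_bigr => u _ do rewrite adj_edges.
rewrite exchange_big /= (bigID (fun e : {set V} => v \in e)) /=.
rewrite [X in _ + X]big1 ?addr0 => [|e /andP[_ /negPf ve]]; last first.
  by rewrite big1 // => u _; rewrite ve !andbF.
rewrite /degree -sum1_card natr_sum; apply: eq_bigr => e /andP[/edge_card e2 ve].
have := cardsD1 v e; rewrite ve e2 => /eqP; rewrite eqSS => /eqP e1.
rewrite e1 -sum1_card natr_sum [RHS]big_mkcond; apply: eq_bigr => u _ /=.
by rewrite !inE andbT; case: (u != v); case: (u \in e).
Qed.

Lemma msize_num_edges G : msize (edges G) = (num_edges G)%:R.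
Proof.
rewrite /msize; transitivity ((2 * (edges_within G [set: V]%SET)%:R) / 2 : R).
  congr (_ / _); rewrite -sum_adj_edges_within [RHS]big_mkcond; apply: eq_bigr => u _.
  by rewrite inE [RHS]big_mkcond; apply: eq_bigr => v _; rewrite inE.
rewrite mulrC mulKf ?pnatr_eq0 //; congr (_%:R); apply: eq_card => e.
by rewrite !inE subsetT andbT.
Qed.

Lemma sum_vol G S : (vol G S)%:R = \sum_(v in S) deg (edges G) v.
Proof. by rewrite /vol natr_sum; apply: eq_bigr => v _; rewrite deg_degree. Qed.

Lemma sum_modmx J : \sum_u \sum_v modmx J u v = 0.
Proof.
(* For size 0 the quotient in [modmx] is 0 by convention, and all adjacency entries vanish because
   they are nonnegative with sum 0. *)
have [m0|m0] := eqVneq (msize J) 0.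
  rewrite big1 // => u _; rewrite big1 // => v _.
  rewrite /modmx m0 mulr0 invr0 mulr0 subr0; apply/eqP.
  have: \sum_u \sum_v adj J u v = 0.
    by move/eqP: m0; rewrite mulf_eq0 invr_eq0 pnatr_eq0 orbF => /eqP.
  move=> /eqP; rewrite psumr_eq0 => [|x _]; last by rewrite sumr_ge0.
  move=> /allP /(_ u); rewrite mem_index_enum => /(_ isT) /=.
  rewrite psumr_eq0 // => /allP /(_ v); rewrite mem_index_enum.
  by move=> /(_ isT).
under eq_bigr => u _ do rewrite sumrB -mulr_suml -mulr_sumr sum_deg.
rewrite sumrB -!mulr_suml sum_deg.
have -> : \sum_u \sum_v adj J u v = 2 * msize J.
  by rewrite /msize mulrC divfK ?pnatr_eq0.
by field.
Qed.

(** Each inner edge is seen from both ends and a squared volume is a double sum of degree products,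
    so both terms of the score are sums over the diagonal blocks of the matrix. *)
Lemma modularity_scoreE G (Pn : {set {set V}}) : num_edges G != 0%N ->
  modularity_score R G Pn =
  (2 * msize (edges G))^-1 * \sum_(S in Pn) \sum_(u in S) \sum_(v in S) modmx (edges G) u v.
Proof.
move=> m0; rewrite /modularity_score /= -msize_num_edges.
have m0' : msize (edges G) != 0 by rewrite msize_num_edges pnatr_eq0.
rewrite !mulr_sumr -sumrB; apply: eq_bigr => S _.
under [in RHS]eq_bigr => u _ do rewrite sumrB -mulr_suml -mulr_sumr -sum_vol.
rewrite sumrB sum_adj_edges_within -!mulr_suml -sum_vol.
by field.
Qed.

Lemma modform_cst J (a : R) : modform J (fun=> a) = 0.
Proof.
rewrite /modform; under eq_bigr => u _ do rewrite -mulr_suml.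
by rewrite -mulr_suml sum_modmx mul0r.
Qed.

End QuadraticForm.

(** * Passing from partitions and fractional assignments to bipartitions *)

Section Bipartition.
Variables (R : realType) (V : finType).
Implicit Types (J : {set {set V}}) (S : {set V}) (s : V -> R) (G : sgraph V).

(* Assigning an independent fair sign to each part keeps the diagonal blocks of
   the modularity matrix and averages the others out. *)
Lemma exists_spin_ge_score G (Pn : {set {set V}}) : num_edges G != 0%N ->
  finset.partition Pn [set: V]%SET ->
  exists S, 2 * msize R (edges G) * modularity_score R G Pn <= modform (edges G) (spin R S).
Proof.
move=> m0 partP; have /and3P[/eqP covP trivP _] := partP.
have m0' : msize R (edges G) != 0 by rewrite msize_num_edges pnatr_eq0.
have m2 : 2 * msize R (edges G) != 0 by apply: mulf_neq0; rewrite ?pnatr_eq0.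
rewrite modularity_scoreE // mulVKf //.
pose P (_ : {set V}) : R := 2^-1.
have P01 i : 0 <= P i <= 1 by apply/andP; rewrite /P; lra.
pose sg (K : {set {set V}}) v : R := if pblock Pn v \in K then 1 else -1.
have sgE u v : Ex P (fun K => sg K u * sg K v) = (pblock Pn u == pblock Pn v)%:R.
  have [uv|uv] := eqVneq.
    rewrite -[RHS](Ex_cst P); apply: eq_Ex => K.
    by rewrite /sg uv; case: ifP => _; rewrite ?mulr1 ?mulrNN ?mulr1.
  (* With probability 1/2 a fair sign is twice the centered indicator, hence the factor 4; distinct
     blocks give independent signs. *)
  rewrite (eq_Ex P (g := fun K => 4 * (centered P (pblock Pn u) K * centered P (pblock Pn v) K))).
    rewrite ExZ Ex_centered_mul0 ?mulr0 //.
    apply: (dep_on_mem (fun b : bool => b%:R - P (pblock Pn v))).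
    by rewrite !inE eq_sym.
  by move=> K; rewrite /sg /centered /P; do 2!case: ifP => _ /=; field.
have [K hK] := Ex_le_exists P01 (fun K => modform (edges G) (sg K)).
exists [set v | pblock Pn v \in K]%SET.
have -> : modform (edges G) (spin R [set v | pblock Pn v \in K]%SET) = modform (edges G) (sg K).
  by apply: eq_bigr => u _; apply: eq_bigr => v _; rewrite /spin /sg !inE.
apply: le_trans hK; rewrite le_eqVlt; apply/orP; left; apply/eqP.
rewrite /modform Ex_sum.
transitivity (\sum_(u in [set: V]%SET) \sum_v modmx R (edges G) u v * (pblock Pn u == pblock Pn v)%:R).
  rewrite -{1}covP big_trivIset //=; apply: eq_bigr => S SP; apply: eq_bigr => u uS.
  have Sv v : (pblock Pn u == pblock Pn v) = (v \in S).
    by rewrite eq_pblock ?covP ?inE // (def_pblock trivP SP uS).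
  rewrite big_mkcond; apply: eq_bigr => v _; rewrite Sv.
  by case: ifP; rewrite ?mulr1 ?mulr0.
rewrite [LHS]big_mkcond; apply: eq_bigr => u _; rewrite inE Ex_sum; apply: eq_bigr => v _.
by rewrite ExZ sgE.
Qed.

(** Each vertex is rounded independently to a sign of mean [s v]. Off-diagonal terms keep their
    expectation; on the diagonal [s v ^+ 2] becomes 1, and the diagonal entries [- deg^2 / (2 m)]
    account for the loss. *)
Lemma exists_spin_ge_frac J s : (forall v, -1 <= s v <= 1) ->
  exists S, modform J s - (\sum_v deg R J v ^+ 2) / (2 * msize R J) <= modform J (spin R S).
Proof.
move=> s1; pose P v : R := (1 + s v) / 2.
have P01 v : 0 <= P v <= 1 by apply/andP; rewrite /P; case/andP: (s1 v); lra.
have spE u v : u != v -> Ex P (fun K => spin R K u * spin R K v) = s u * s v.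
  move=> uv; rewrite (@Ex_indep _ _ _ [set u]%SET).
  - rewrite /spin (Ex_mem P u (fun b => if b then 1 else -1)).
    by rewrite (Ex_mem P v (fun b => if b then 1 else -1)) /P /=; field.
  - by apply: (dep_on_mem (fun b => if b then 1 else -1)); rewrite inE.
  - by apply: (dep_on_mem (fun b => if b then 1 else -1)); rewrite !inE eq_sym.
have m0 : 0 <= (2 * msize R J)^-1.
  by rewrite invr_ge0 -sum_deg sumr_ge0 // => v _; rewrite sumr_ge0.
have [S hS] := Ex_le_exists P01 (fun K => modform J (spin R K)).
exists S; apply: le_trans hS; rewrite /modform Ex_sum mulr_suml -sumrB.
apply: ler_sum => u _; rewrite Ex_sum (bigD1 u) //= [leRHS](bigD1 u) //= addrAC.
apply: lerD; last first.
  by apply: ler_sum => v vu; rewrite ExZ spE // eq_sym.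
have -> : Ex P (fun K => modmx R J u u * (spin R K u * spin R K u)) = modmx R J u u.
  rewrite -[RHS](Ex_cst P); apply: eq_Ex => K.
  by rewrite /spin; case: ifP; rewrite ?mulrNN !mulr1.
rewrite /modmx adj_diag sub0r -expr2.
have d0 : 0 <= deg R J u ^+ 2 / (2 * msize R J) by rewrite mulr_ge0 ?sqr_ge0.
have s0 : 0 <= s u * s u by rewrite -expr2 sqr_ge0.
move: d0; set d := _ / _; nra.
Qed.

(** The product of two spins is twice the indicator of equal sides minus 1, and the part from [-1]
    vanishes by [sum_modmx]. *)
Lemma modform_spin J S : modform J (spin R S) =
  2 * (\sum_(u in S) \sum_(v in S) modmx R J u v +
       \sum_(u in ~: S) \sum_(v in ~: S) modmx R J u v).
Proof.
have split (F : V -> R) : \sum_v F v = \sum_(v in S) F v + \sum_(v in ~: S) F v.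
  by rewrite (bigID (mem S)) /=; congr (_ + _); apply: eq_bigl => v; rewrite inE.
have H := sum_modmx R J; rewrite /modform.
have e1 u v : modmx R J u v * (spin R S u * spin R S v) =
    modmx R J u v * (2 * ((u \in S) == (v \in S))%:R - 1).
  by rewrite /spin; do 2!case: ifP => _ /=; ring.
under eq_bigr => u _ do under eq_bigr => v _ do rewrite e1 mulrBr mulr1.
under eq_bigr => u _ do rewrite sumrB.
rewrite sumrB H subr0 split mulrDr !mulr_sumr.
congr (_ + _); apply: eq_bigr => u uS; rewrite mulr_sumr [RHS]big_mkcond;
  apply: eq_bigr => v _; move: uS; rewrite ?inE; case: (u \in S) => // _;
  by case: (v \in S) => /=; ring.
Qed.

(** The parts [S] and [~: S] compete in the maximum. If one of them is empty they form no partition,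
    but then the form is 0, which is the score of the one-part default. *)
Lemma modularity_ge_spin G S : num_edges G != 0%N ->
  modform (edges G) (spin R S) <= 4 * msize R (edges G) * modularity R G.
Proof.
move=> m0; have m0' : 0 < msize R (edges G) by rewrite msize_num_edges ltr0n lt0n.
have m4 : 0 < 4 * msize R (edges G) by apply: mulr_gt0.
rewrite -ler_pdivrMl // /modularity (negPf m0).
apply/bigmax_geP.
have scT : modularity_score R G [set [set: V]]%SET = 0.
  rewrite modularity_scoreE // big_set1.
  have -> : \sum_(u in [set: V]%SET) \sum_(v in [set: V]%SET) modmx R (edges G) u v =
     \sum_u \sum_v modmx R (edges G) u v.
    rewrite big_mkcond; apply: eq_bigr => u _; rewrite inE big_mkcond.
    by apply: eq_bigr => v _; rewrite inE.
  by rewrite sum_modmx mulr0.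
have [->|S0] := eqVneq S set0.
  left; rewrite scT (_ : modform _ _ = 0) ?mulr0 // -[RHS](modform_cst (edges G) (-1)).
  by apply: eq_bigr => u _; apply: eq_bigr => v _; rewrite /spin !inE.
have [->|ST] := eqVneq S [set: V]%SET.
  left; rewrite scT (_ : modform _ _ = 0) ?mulr0 // -[RHS](modform_cst (edges G) 1).
  by apply: eq_bigr => u _; apply: eq_bigr => v _; rewrite /spin !inE.
have SC0 : ~: S != set0 by apply: contraNneq ST => S0'; rewrite -(setCK S) S0' setC0.
have SSC : S != ~: S.
  apply: contraTneq S0 => /setP SS; case/set0Pn: SC0 => v.
  by rewrite negbK; have := SS v; rewrite !inE; case: (v \in S).
right; exists [set S; ~: S]%SET.
  apply/and3P; split.
  - by rewrite /cover big_setU1 ?inE //= big_set1 setUCr.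
  - apply/trivIsetP => A B; rewrite !inE => /orP[] /eqP-> /orP[] /eqP->;
    by rewrite ?eqxx // -setI_eq0 ?(setIC (~: S)) setICr.
  - by rewrite !inE negb_or !(eq_sym set0) S0.
rewrite modularity_scoreE // big_setU1 ?inE //= big_set1 modform_spin.
rewrite le_eqVlt; apply/orP; left; apply/eqP; rewrite mulrA; congr (_ * _).
by field; rewrite gt_eqF.
Qed.

(** With [c = m - a - b] the number of crossing edges, the two volumes are [2 a + c] and
    [2 b + c]. *)
Lemma modform_spin_edges G S (a b m : R) : num_edges G != 0%N ->
  a = (edges_within G S)%:R -> b = (edges_within G (~: S))%:R -> m = (num_edges G)%:R ->
  modform (edges G) (spin R S) = 2 / m * (4 * a * b - (m - a - b) ^+ 2).
Proof.
move=> m0 ea eb em.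
have m0' : m != 0 by rewrite em pnatr_eq0.
have sq (T : {set V}) : \sum_(u in T) \sum_(v in T) modmx R (edges G) u v =
    2 * (edges_within G T)%:R - (\sum_(u in T) deg R (edges G) u) ^+ 2 / (2 * m).
  under eq_bigr => u _ do rewrite sumrB -mulr_suml -mulr_sumr.
  by rewrite sumrB sum_adj_edges_within -!mulr_suml msize_num_edges -em expr2.
have split (F : V -> R) : \sum_v F v = \sum_(v in S) F v + \sum_(v in ~: S) F v.
  by rewrite (bigID (mem S)) /=; congr (_ + _); apply: eq_bigl => v; rewrite inE.
have volD (T : {set V}) : \sum_(u in T) deg R (edges G) u = 2 * (edges_within G T)%:R +
    \sum_(u in T) \sum_(v in ~: T) adj R (edges G) u v.
  rewrite -sum_adj_edges_within -big_split; apply: eq_bigr => u _ /=.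
  rewrite /deg (bigID (mem T)) /=; congr (_ + _); apply: eq_big => v; rewrite ?inE //;
  by rewrite adjC.
have cut : \sum_(u in ~: S) \sum_(v in S) adj R (edges G) u v =
    \sum_(u in S) \sum_(v in ~: S) adj R (edges G) u v.
  by rewrite exchange_big; apply: eq_bigr => u _; apply: eq_bigr => v _; rewrite adjC.
have := sum_deg R (edges G); rewrite split msize_num_edges -em.
rewrite modform_spin !sq !volD setCK cut -ea -eb.
set c := \sum_(u in S) _ => hm.
have -> : c = m - a - b by lra.
by field.
Qed.

End Bipartition.

(** * The random graph as a random family of vertex sets *)

Section RandomGraph.
Variables (R : realType) (n : nat) (p : R).
Implicit Types (G : sgraph 'I_n) (J : {set {set 'I_n}}).

(* G(n,p) is a random subset of all sets of vertices, in which the sets that are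
   not pairs have probability 0. *)
Definition edge_prob (e : {set 'I_n}) : R := if e \in vpairs 'I_n then p else 0.

Lemma edges_vpairs G : edges G \subset vpairs 'I_n.
Proof. by case: G. Qed.

Lemma bweight_edges G : bweight edge_prob (edges G) = gnp_weight p G.
Proof.
rewrite /bweight /gnp_weight [RHS]big_mkcond; apply: eq_bigr => e _.
rewrite /edge_prob; case: ifP => eG; last by case: ifP => // _; rewrite subr0.
by rewrite (subsetP (edges_vpairs G) _ eG).
Qed.

Lemma bweight_not_vpairs J : ~~ (J \subset vpairs 'I_n) -> bweight edge_prob J = 0.
Proof.
case/subsetPn => e eJ eV; rewrite /bweight (bigD1 e) //= eJ /edge_prob (negPf eV).
by rewrite mul0r.
Qed.

Lemma sum_gnp_weight (f : {set {set 'I_n}} -> R) :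
  \sum_G gnp_weight p G * f (edges G) = Ex edge_prob f.
Proof.
rewrite /Ex (bigID (fun J => J \subset vpairs 'I_n)) /= [X in _ + X]big1 ?addr0; last first.
  by move=> J JV; rewrite bweight_not_vpairs ?mul0r.
(* The empty graph only serves as the default of [insubd], which is not reached on families of
   pairs. *)
pose G0 : sgraph 'I_n := SGraph (sub0set _).
rewrite (reindex_onto (@edges 'I_n) (insubd G0)) /= => [|J JV]; last exact: insubdK.
apply: eq_big => [G|G _]; last by rewrite bweight_edges.
by rewrite edges_vpairs /= valKd eqxx.
Qed.

Hypothesis p01 : 0 <= p <= 1.

Lemma edge_prob01 e : 0 <= edge_prob e <= 1.
Proof. by rewrite /edge_prob; case: ifP => _ //; rewrite lexx ler01. Qed.

(** Transfers estimates from random families to graphs: it suffices to bound the probability of a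
    bad event [B] outside which [A] holds. *)
Lemma gnp_prob_ge (A : pred (sgraph 'I_n)) (B : pred {set {set 'I_n}}) :
  (forall G, ~~ B (edges G) -> A G) -> 1 - Pr edge_prob B <= gnp_prob p A.
Proof.
move=> BA; rewrite -PrC /Pr -sum_gnp_weight /gnp_prob [leRHS]big_mkcond; apply: ler_sum => G _.
have w0 : 0 <= gnp_weight p G by rewrite -bweight_edges bweight_ge0 //; exact: edge_prob01.
have := BA G; case: (~~ B _) => [->//|_]; first by rewrite mulr1.
by rewrite mulr0; case: ifP.
Qed.

Lemma gnp_prob_le1 (A : pred (sgraph 'I_n)) : gnp_prob p A <= 1.
Proof.
rewrite -[leRHS](Ex_cst edge_prob) -sum_gnp_weight /gnp_prob [leLHS]big_mkcond.
apply: ler_sum => G _; rewrite mulr1; case: ifP => // _.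
by rewrite -bweight_edges bweight_ge0 //; exact: edge_prob01.
Qed.

End RandomGraph.

(** * A two-sided Chernoff bound *)

Section Chernoff.
Variable R : realType.

(** [expR x <= 1 / (1 - x)], and multiplying the quadratic by [1 - x] gives
    [1 + x^2 (1 - 2 x) >= 1]. *)
Lemma expR_le_quadratic (x : R) : x <= 2^-1 -> expR x <= 1 + x + 2 * x ^+ 2.
Proof.
move=> x2; have x1 : 0 < 1 - x by lra.
have h : 1 - x <= expR (- x) by rewrite -[X in X <= _]/(1 + - x) expR_ge1Dx.
have : expR x <= (1 - x)^-1.
  by rewrite -[expR x]invrK -expRN lef_pV2 ?posrE // expR_gt0.
move/le_trans; apply; rewrite -[_^-1]mul1r ler_pdivrMr //.
have := sqr_ge0 x; nra.
Qed.

Lemma Pr_chernoff (I : finType) (P : I -> R) (F : {set I}) (p theta delta : R)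
    (N := #|F|%:R : R) (X := fun J : {set I} => \sum_(i in F) (i \in J)%:R : R) :
  (forall i, 0 <= P i <= 1) -> {in F, forall i, P i = p} -> 0 < theta <= 2^-1 ->
  Pr P (fun J => delta <= `|X J - p * N|) <=
  2 * expR (2 * p * N * theta ^+ 2 - theta * delta).
Proof.
move=> P01 PF /andP[t0 t1].
(* The exponential moment of the deviation, valid for [l <= 1/2]; it is applied with [l = theta] and
   [l = - theta] for the two tails. *)
have mgf (l : R) : l <= 2^-1 ->
    Ex P (fun J => expR (l * (X J - p * N))) <= expR (2 * p * N * l ^+ 2).
  move=> l1.
  rewrite (eq_Ex P (g := fun J => expR (- (l * p * N)) *
      \prod_i (if i \in J then (if i \in F then expR l else 1) else 1))); last first.
    move=> J; rewrite mulrBr addrC expRD mulrA; congr (_ * _).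
    rewrite mulr_sumr expR_sum big_mkcond; apply: eq_bigr => i _.
    by case: (i \in F); case: (i \in J); rewrite ?mulr1 ?mulr0 ?expR0.
  rewrite ExZ Ex_prod.
  have -> : 2 * p * N * l ^+ 2 = - (l * p * N) + N * (p * (l + 2 * l ^+ 2)) by ring.
  rewrite expRD ler_pM2l ?expR_gt0 // /N expRM_natl -prodr_const.
  rewrite [leRHS]big_mkcond; apply: ler_prod => i _.
  have /andP[Pi0 Pi1] := P01 i; case: ifP => iF; last by apply/andP; lra.
  apply/andP; split; first by rewrite addr_ge0 // mulr_ge0 ?expR_ge0 // subr_ge0.
  (* Each factor is [1 + p (expR l - 1) <= 1 + p (l + 2 l^2)], which is at most the exponential of
     [p (l + 2 l^2)]. *)
  apply: le_trans (expR_ge1Dx _); move: Pi0; rewrite PF // => p0.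
  have := ler_wpM2l p0 (expR_le_quadratic l1); lra.
pose B1 J := delta <= X J - p * N; pose B2 J := delta <= - (X J - p * N).
have tail (l : R) (B : pred {set I}) : l <= 2^-1 ->
    (forall J, B J -> theta * delta <= l * (X J - p * N)) -> l ^+ 2 = theta ^+ 2 ->
    Pr P B <= expR (2 * p * N * theta ^+ 2 - theta * delta).
  move=> l1 hB lt; rewrite expRB -lt.
  apply: le_trans (Pr_markov P01 (f := fun J => expR (l * (X J - p * N))) (expR_gt0 _) _ _) _.
  - by move=> J; apply: expR_ge0.
  - by move=> J /hB h; rewrite ler_expR; exact: h.
  - by rewrite ler_pM2r ?invr_gt0 ?expR_gt0 // mgf.
have h1 : Pr P B1 <= expR (2 * p * N * theta ^+ 2 - theta * delta).
  by apply: (tail theta) => // J; rewrite /B1 ler_pM2l.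
have h2 : Pr P B2 <= expR (2 * p * N * theta ^+ 2 - theta * delta).
  apply: (tail (- theta)); rewrite ?sqrrN //; first lra.
  by move=> J; rewrite /B2 mulNr -mulrN ler_pM2l.
rewrite mulr2n mulrDl !mul1r; apply: le_trans (lerD h1 h2).
apply: le_trans (PrU P01 _ _); apply: Pr_sub => // J.
by rewrite !unfold_in /B1 /B2 ler_normr.
Qed.

End Chernoff.

(** * The upper bound *)

Section UpperBound.
Variable R : realType.

Lemma bin2_natr k : 'C(k, 2)%:R = k%:R * (k%:R - 1) / 2 :> R.
Proof.
have h : ('C(k, 2) * 2)%:R = (k * k.-1)%:R :> R.
  by have := bin_ffact k 2; rewrite ffactnS ffactn1 => ->.
apply: (@mulIf _ 2); first by rewrite pnatr_eq0.
rewrite divfK ?pnatr_eq0 // -natrM h natrM; case: k {h} => [|k]; first by rewrite !mul0r.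
by rewrite -[k.+1]addn1 natrD addrK addn1.
Qed.

Definition pairs_within n (S : {set 'I_n}) : {set {set 'I_n}} :=
  [set e : {set 'I_n} | e \subset S & #|e| == 2%N]%SET.

(** Number of edges inside [S] as a sum of independent indicators, the shape required by the
    Chernoff bound. *)
Definition pair_count n (S : {set 'I_n}) (J : {set {set 'I_n}}) : R :=
  \sum_(e in pairs_within S) (e \in J)%:R.

Lemma pair_count_edges n (S : {set 'I_n}) (G : sgraph 'I_n) :
  pair_count S (edges G) = (edges_within G S)%:R.
Proof.
rewrite /pair_count /edges_within -sum1_card natr_sum [LHS]big_mkcond [RHS]big_mkcond.
apply: eq_bigr => e _ /=; rewrite !inE; case eG: (e \in edges G) => /=.
  by rewrite (edge_card eG) eqxx andbT.
by case: ifP.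
Qed.

Lemma edges_withinT n (G : sgraph 'I_n) : edges_within G [set: 'I_n]%SET = num_edges G.
Proof. by apply: eq_card => e; rewrite !inE subsetT andbT. Qed.

Lemma edges_withinC_le n (S : {set 'I_n}) (G : sgraph 'I_n) :
  (edges_within G S + edges_within G (~: S) <= num_edges G)%N.
Proof.
rewrite /edges_within -cardUI [X in (_ + X)%N]eq_card0 ?addn0 => [|e]; last first.
  rewrite !inE; apply/negP => /andP[/andP[eG eS] /andP[_ eC]].
  have : #|e| == 0%N by rewrite cards_eq0 -subset0 -(setICr S) subsetI eS.
  by rewrite (edge_card eG).
by apply: subset_leq_card; apply/subsetP => e; rewrite !inE => /orP[] /andP[].
Qed.

(* A union bound over all 2^n vertex sets suffices because partitions reduce to
   bipartitions; theta = 1/d balances the Chernoff exponent at -2n. *)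
Lemma Pr_pair_count_deviation n (p d : R) : 0 <= p <= 1 -> 2 <= d -> d ^+ 2 = n%:R * p ->
  Pr (edge_prob p) (fun J => [exists S : {set 'I_n},
     3 * n%:R * d <= `|pair_count S J - p * 'C(#|S|, 2)%:R|]) <= 2 * expR (- n%:R).
Proof.
move=> p01 d2 dE; have d0 : 0 < d by lra.
have P01 := edge_prob01 (n := n) p01; have /andP[p0 p1] := p01.
apply: le_trans (Pr_exists P01 _) _.
have tail (S : {set 'I_n}) : Pr (edge_prob p) (fun J =>
    3 * n%:R * d <= `|pair_count S J - p * 'C(#|S|, 2)%:R|) <= 2 * expR (- (n%:R * 2)).
  rewrite -cards_draws.
  apply: le_trans (Pr_chernoff (theta := d^-1) (3 * n%:R * d) P01 (p := p) _ _) _.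
  - by move=> e; rewrite inE /edge_prob inE => /andP[_ ->].
  - by rewrite invr_gt0 d0 lef_pV2 ?posrE.
  rewrite ler_pM2l // ler_expR cards_draws bin2_natr.
  have -> : d^-1 * (3 * n%:R * d) = 3 * n%:R by field; rewrite gt_eqF.
  suff : 2 * p * (#|S|%:R * (#|S|%:R - 1) / 2) * d^-1 ^+ 2 <= n%:R by lra.
  rewrite exprVn ler_pdivrMr ?exprn_gt0 // dE.
  have -> : 2 * p * (#|S|%:R * (#|S|%:R - 1) / 2) = #|S|%:R * (#|S|%:R - 1) * p by field.
  rewrite mulrA ler_wpM2r //.
  have S0 : 0 <= #|S|%:R :> R by [].
  have Sn : #|S|%:R <= n%:R :> R.
    by rewrite ler_nat -[leqRHS]card_ord max_card.
  nra.
apply: le_trans (ler_sum _ (fun S _ => tail S)) _.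
rewrite sumr_const -cardsT. rewrite -powersetT card_powerset.
rewrite cardsT card_ord -[leLHS]mulr_natl mulrCA ler_pM2l //.
(* One of the two factors [expR (- n)] pays for the [2^n] vertex sets, since [2 <= expR 1]. *)
have -> : expR (- (n%:R * 2)) = expR (- n%:R) * expR (- n%:R) :> R.
  by rewrite -expRD; congr expR; ring.
rewrite mulrA -[leRHS]mul1r ler_pM2r ?expR_gt0 // expRN ler_pdivrMr ?expR_gt0 // mul1r.
rewrite natrX -[n%:R]mulr1 expRM_natl lerXn2r ?nnegrE ?expR_ge0 //.
by apply: le_trans (expR_ge1Dx 1); lra.
Qed.

(** Here [x], [y] are the sizes of the two sides. The leading terms [(p x^2) (p y^2)] and
    [(p x y)^2] cancel, and only terms with a factor [delta] survive. *)
Lemma bipartition_excess_le (p x y delta a b c : R) : 0 <= p -> 0 <= x -> 0 <= y ->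
  0 <= delta -> 0 <= a -> 0 <= b -> 0 <= c ->
  a <= p * (x * (x - 1) / 2) + delta -> b <= p * (y * (y - 1) / 2) + delta ->
  p * (x * y) - 3 * delta <= c ->
  4 * a * b - c ^+ 2 <= 3 * delta * (p * (x + y) ^+ 2) + 4 * delta ^+ 2.
Proof.
move=> p0 x0 y0 d0 a0 b0 c0 ha hb hc.
have px0 : 0 <= p * x by rewrite mulr_ge0.
have py0 : 0 <= p * y by rewrite mulr_ge0.
have pxy0 : 0 <= p * (x * y) by rewrite !mulr_ge0.
have ha' : 2 * a <= p * x ^+ 2 + 2 * delta by lra.
have hb' : 2 * b <= p * y ^+ 2 + 2 * delta by lra.
have hab : (2 * a) * (2 * b) <= (p * x ^+ 2 + 2 * delta) * (p * y ^+ 2 + 2 * delta).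
  by apply: ler_pM; rewrite ?mulr_ge0.
have hc2 : (p * (x * y)) ^+ 2 - 6 * delta * (p * (x * y)) <= c ^+ 2.
  move: hc pxy0; set u := p * (x * y) => hc u0.
  (* If [u < 3 * delta] the lower bound on [c] is negative and cannot be squared, but then
     [u (u - 6 delta)] is itself nonpositive. *)
  have [ud|ud] := leP (3 * delta) u.
    have h : (u - 3 * delta) ^+ 2 <= c ^+ 2 by rewrite lerXn2r ?nnegrE // subr_ge0.
    by have := sqr_ge0 delta; nra.
  by have := sqr_ge0 c; nra.
have dp0 : 0 <= delta * p by rewrite mulr_ge0.
have pp : 0 <= delta * p * (x - y) ^+ 2 by rewrite mulr_ge0 ?sqr_ge0.
have -> : 4 * a * b = (2 * a) * (2 * b) by ring.
have dpx : 0 <= delta * p * x ^+ 2 by rewrite mulr_ge0 ?sqr_ge0.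
have dpy : 0 <= delta * p * y ^+ 2 by rewrite mulr_ge0 ?sqr_ge0.
lra.
Qed.

(** Combines the reduction to a bipartition, [2 m q <= modform], with
    [modform = 2 / m (4 a b - c^2)]. *)
Lemma modularity_score_le_excess n (G : sgraph 'I_n) (Pn : {set {set 'I_n}}) (K : R) :
  num_edges G != 0%N -> finset.partition Pn [set: 'I_n]%SET ->
  (forall (S : {set 'I_n}) (a b c : R), a = (edges_within G S)%:R ->
     b = (edges_within G (~: S))%:R -> c = (num_edges G)%:R - a - b ->
     4 * a * b - c ^+ 2 <= K) ->
  modularity_score R G Pn <= K / (num_edges G)%:R ^+ 2.
Proof.
move=> m0 /(exists_spin_ge_score R m0)[S hS] hK.
have m0' : 0 < (num_edges G)%:R :> R by rewrite ltr0n lt0n.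
rewrite ler_pdivlMr ?exprn_gt0 //.
move: hS; rewrite (modform_spin_edges m0 erefl erefl erefl) msize_num_edges.
have := hK S _ _ _ erefl erefl erefl.
set e := 4 * _ * _ - _; set m : R := _%:R in m0' *; set q := modularity_score _ _ _ => he.
move=> h; apply: le_trans he; rewrite mulrC expr2 -mulrA.
have : m / 2 * (2 * m * q) <= m / 2 * (2 / m * e) by rewrite ler_pM2l // divr_gt0.
have -> : m / 2 * (2 / m * e) = e by field; rewrite gt_eqF.
by have -> : m / 2 * (2 * m * q) = m * (m * q) by field.
Qed.

Lemma modularity_ltP n (G : sgraph 'I_n) (x : R) : 0 < x ->
  (num_edges G != 0%N -> forall Pn : {set {set 'I_n}},
     finset.partition Pn [set: 'I_n]%SET -> modularity_score R G Pn < x) ->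
  modularity R G < x.
Proof.
move=> x0 h; rewrite /modularity; case: ifPn => // m0.
(* An edge supplies a vertex, so the one-part default is a genuine partition and obeys the bound. *)
have /set0Pn[e eG] : edges G != set0 by rewrite -cards_eq0.
have e2 := edge_card eG.
have /set0Pn[v ve] : e != set0 by rewrite -cards_eq0 e2.
apply/bigmax_ltP; split => [|Pn]; last exact: h.
apply: h => //; apply/and3P; split; first by rewrite /cover big_set1.
  by apply/trivIsetP => A B; rewrite !inE => /eqP-> /eqP->; rewrite eqxx.
by rewrite inE eq_sym; apply/set0Pn; exists v; rewrite inE.
Qed.

(** [4 a b <= (a + b)^2 <= m^2]. This handles bounded average degree. *)
Lemma modularity_le1 n (G : sgraph 'I_n) (x : R) : 1 < x -> modularity R G < x.
Proof.
move=> x1; apply: modularity_ltP => [|m0 Pn partP]; first by lra.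
apply: le_lt_trans x1; have m0' : 0 < (num_edges G)%:R :> R by rewrite ltr0n lt0n.
have := @modularity_score_le_excess n G Pn ((num_edges G)%:R ^+ 2) m0 partP.
rewrite divff ?expf_neq0 ?gt_eqF //; apply => S a b c ea eb ec.
have : a + b <= (num_edges G)%:R.
  by rewrite ea eb -natrD ler_nat edges_withinC_le.
have a0 : 0 <= a by rewrite ea.
have b0 : 0 <= b by rewrite eb.
by have := sqr_ge0 (a - b); have := sqr_ge0 c; nra.
Qed.

(** With [delta = 3 n d] the excess has order [n^2 d^3], while [m^2] has order [n^2 d^4]; the
    quotient has order [1 / d]. *)
Lemma modularity_lt_of_pair_count n (p d : R) (G : sgraph 'I_n) : 0 <= p <= 1 -> (2 <= n)%N ->
  0 < d -> d ^+ 2 = n%:R * p ->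
  (forall S : {set 'I_n}, `|pair_count S (edges G) - p * 'C(#|S|, 2)%:R| < 3 * n%:R * d) ->
  modularity R G < 1000 / d.
Proof.
move=> /andP[p0 p1] n2 d0 dE dev.
have [d1000|d1000] := ltP d 1000.
  by apply: modularity_le1; rewrite ltr_pdivlMr // mul1r.
have N2 : 2 <= n%:R :> R by rewrite ler_nat.
have devS (S : {set 'I_n}) : (edges_within G S)%:R <=
    p * (#|S|%:R * (#|S|%:R - 1) / 2) + 3 * n%:R * d :> R.
  have := dev S; rewrite pair_count_edges bin2_natr ltr_norml => /andP[_]; lra.
have devm : p * (n%:R * (n%:R - 1) / 2) - 3 * n%:R * d <= (num_edges G)%:R.
  have := dev [set: 'I_n]%SET.
  rewrite pair_count_edges edges_withinT bin2_natr cardsT card_ord ltr_norml => /andP[+ _]; lra.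
(* The mean is at least [n d^2 / 4] because [n >= 2], and the deviation [3 n d] is at most
   [n d^2 / 8] because [d >= 24]. *)
have m_ge : n%:R * d ^+ 2 / 8 <= (num_edges G)%:R.
  apply: le_trans devm.
  have -> : p * (n%:R * (n%:R - 1) / 2) = d ^+ 2 * (n%:R - 1) / 2 by rewrite dE; ring.
  have h1 : 0 <= d ^+ 2 * (n%:R - 2) by rewrite mulr_ge0 ?sqr_ge0 ?subr_ge0.
  have h2 : 0 <= n%:R * d * (d - 24) by rewrite !mulr_ge0 ?subr_ge0 //; lra.
  lra.
have nd0 : 0 < n%:R * d ^+ 2 / 8 :> R.
  by rewrite divr_gt0 // mulr_gt0 ?exprn_gt0 //; lra.
have m0 : 0 < (num_edges G)%:R :> R by apply: lt_le_trans m_ge.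
have x0 : 0 < 1000 / d by rewrite divr_gt0 ?ltr0n.
apply: modularity_ltP => // m0' Pn partP.
apply: le_lt_trans (@modularity_score_le_excess n G Pn
  (3 * (3 * n%:R * d) * (p * n%:R ^+ 2) + 4 * (3 * n%:R * d) ^+ 2) m0' partP _) _.
  move=> S a b c ea eb ec.
  have cardS : #|S|%:R + #|~: S|%:R = n%:R :> R by rewrite -natrD cardsC card_ord.
  rewrite -cardS; apply: bipartition_excess_le => //; rewrite ?cardS ?ea ?eb //.
  - by rewrite !mulr_ge0 // ltW.
  - by rewrite ec subr_ge0 lerBrDr addrC ea eb -natrD ler_nat edges_withinC_le.
  rewrite ec ea eb.
  (* The pairs within the two sides, taken from all pairs, leave the [x y] crossing ones; three
     deviations add up to [3 * delta]. *)
  have := devS S; have := devS (~: S); move: devm; rewrite -cardS; lra.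
rewrite ltr_pdivrMr ?exprn_gt0 //.
have e1 : p * n%:R ^+ 2 = n%:R * d ^+ 2 by rewrite dE; ring.
rewrite e1.
have h : (n%:R * d ^+ 2 / 8) ^+ 2 <= (num_edges G)%:R ^+ 2 :> R.
  by rewrite lerXn2r ?nnegrE // ltW.
apply: lt_le_trans (ler_wpM2l (ltW x0) h).
have -> : 1000 / d * (n%:R * d ^+ 2 / 8) ^+ 2 = 125 / 8 * (n%:R ^+ 2 * d ^+ 3).
  by field; rewrite gt_eqF.
have -> : 3 * (3 * n%:R * d) * (n%:R * d ^+ 2) + 4 * (3 * n%:R * d) ^+ 2 =
  n%:R ^+ 2 * d ^+ 2 * (9 * d + 36) by ring.
have -> : 125 / 8 * (n%:R ^+ 2 * d ^+ 3) = n%:R ^+ 2 * d ^+ 2 * (125 / 8 * d) by ring.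
rewrite ltr_pM2l; first by lra.
by rewrite mulr_gt0 ?exprn_gt0 //; lra.
Qed.

(** Squeeze between [1 - C / sqrt n] and 1; the rate [1 / sqrt n] is the one that the lower bound
    provides. *)
Lemma whp_of_le_div_sqrt (p : nat -> R) (A : forall n, pred (sgraph 'I_n)) (C : R) :
  (forall n, 0 <= p n <= 1) ->
  (\forall n \near \oo%classic, 1 - C / Num.sqrt n%:R <= gnp_prob (p n) (A n)) ->
  gnp_whp p A.
Proof.
move=> p01 h; rewrite /gnp_whp.
apply: (@squeeze_cvgr _ _ _ _ (fun n : nat => 1 - C / Num.sqrt n%:R) (fun=> 1)).
- by apply: filterS h => n ->; rewrite gnp_prob_le1.
- rewrite -[X in (_ --> X)%classic]subr0; apply: cvgB; first exact: cvg_cst.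
  rewrite -(mulr0 C); apply: cvgM; first exact: cvg_cst.
  apply/cvgr0Pnorm_lt => e e0; near=> n.
  have en : e ^- 2 < n%:R by near: n; exact: nbhs_infty_gtr.
  have n0 : 0 < n%:R :> R by apply: lt_trans en; rewrite invr_gt0 exprn_gt0.
  rewrite gtr0_norm ?invr_gt0 ?sqrtr_gt0 // -[e]invrK ltf_pV2 ?posrE ?sqrtr_gt0 ?invr_gt0 //.
  rewrite -[e^-1]gtr0_norm ?invr_gt0 // -sqrtr_sqr ltr_sqrt //.
  by rewrite exprVn.
- exact: cvg_cst.
Unshelve. all: by end_near.
Qed.

Lemma modularity_upper_whp (p : nat -> R) : (forall n, 0 < p n <= 1) ->
  gnp_whp p (fun n G => modularity R G < 1000 / Num.sqrt (n%:R * p n)).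
Proof.
move=> p01; have p01' n : 0 <= p n <= 1 by case/andP: (p01 n) => /ltW -> ->.
apply: (whp_of_le_div_sqrt (C := 2)) => //; near=> n.
have n2 : (2 <= n)%N by near: n; exact: nbhs_infty_ge.
set d := Num.sqrt (n%:R * p n).
have n0 : 0 < n%:R :> R by rewrite ltr0n; lia.
have np0 : 0 < n%:R * p n by rewrite mulr_gt0 //; case/andP: (p01 n).
have d0 : 0 < d by rewrite sqrtr_gt0.
have dE : d ^+ 2 = n%:R * p n by rewrite sqr_sqrtr ?ltW.
have sn : 0 < Num.sqrt n%:R :> R by rewrite sqrtr_gt0.
have C0 : 0 <= 2 / Num.sqrt n%:R :> R by rewrite divr_ge0 // ltW.
(* For [d < 2] the claimed bound exceeds 1 and holds for every graph, so the empty bad event is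
   taken; for [d >= 2] the Chernoff parameter [1 / d] is admissible. *)
have [d2|d2] := ltP d 2.
  rewrite (_ : gnp_prob _ _ = 1); first by rewrite gerBl.
  apply/eqP; rewrite eq_le gnp_prob_le1 //=.
  apply: le_trans (gnp_prob_ge (p01' n) (B := pred0) _); last first.
    by move=> G _; apply: modularity_le1; rewrite ltr_pdivlMr // mul1r; lra.
  by rewrite /Pr Ex_cst subr0.
apply: le_trans (gnp_prob_ge (p01' n) (B := fun J => [exists S : {set 'I_n},
     3 * n%:R * d <= `|pair_count S J - p n * 'C(#|S|, 2)%:R|]) _); last first.
  move=> G; rewrite negb_exists => /forallP dev.
  apply: (modularity_lt_of_pair_count (p01' n)) => // S.
  by rewrite ltNge dev.
rewrite lerD2l lerN2; apply: le_trans (Pr_pair_count_deviation (p01' n) d2 dE) _.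
rewrite ler_pM2l // expRN lef_pV2 ?posrE ?expR_gt0 //.
apply: le_trans (expR_ge1Dx _).
rewrite -[n%:R in leRHS]sqr_sqrtr ?ltW //; have := sqr_ge0 (Num.sqrt n%:R - 1 : R).
move: sn; set s := Num.sqrt _; nra.
Unshelve. all: by end_near.
Qed.

End UpperBound.

(** * Second moments of sums over pairs of vertices *)

Section PairSums.
Variables (R : realType) (n : nat) (p : R).
Hypothesis p01 : 0 <= p <= 1.
Local Notation V := 'I_n.
Local Notation P := (@edge_prob R n p).
Let P01 := edge_prob01 (n := n) p01.

(** Adjacency minus its mean, equal to 0 on the diagonal so that sums may run over all ordered
    pairs. *)
Definition cadj (u v : V) (J : {set {set V}}) : R := adj R J u v - (u != v)%:R * p.

Lemma cadjE u v J : u != v -> cadj u v J = centered P [set u; v]%SET J.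
Proof. by move=> uv; rewrite /cadj /adj /centered /edge_prob inE cards2 uv mul1r. Qed.

Lemma cadjC u v J : cadj u v J = cadj v u J.
Proof. by rewrite /cadj adjC eq_sym. Qed.

Lemma cadj_diag u J : cadj u u J = 0.
Proof. by rewrite /cadj adj_diag eqxx mul0r subrr. Qed.

Lemma adj_cadj u v J : adj R J u v = (u != v)%:R * p + cadj u v J.
Proof. by rewrite /cadj addrC subrK. Qed.

Lemma Ex_cadj_sqr_le u v : Ex P (fun J => cadj u v J ^+ 2) <= p.
Proof.
have /andP[p0 p1] := p01; have [->|uv] := eqVneq u v.
  by rewrite (eq_Ex P (g := fun=> 0)) ?Ex_cst // => J; rewrite cadj_diag expr0n.
rewrite (eq_Ex P (g := fun J => centered P [set u; v]%SET J ^+ 2)); last first.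
  by move=> J; rewrite cadjE.
by rewrite Ex_centered_sqr /edge_prob inE cards2 uv /=; nra.
Qed.

Lemma dep_on_adj u v (F : {set {set V}}) : (u != v -> [set u; v]%SET \in F) -> dep_on F (fun J => adj R J u v).
Proof.
move=> uvF J K JK; rewrite /adj; case: eqVneq => //= uv.
exact: (dep_on_mem (fun b : bool => b%:R : R) (uvF uv) JK).
Qed.

Lemma dep_on_cadj u v (F : {set {set V}}) : (u != v -> [set u; v]%SET \in F) -> dep_on F (cadj u v).
Proof. by move=> uvF J K JK; rewrite /cadj (dep_on_adj uvF JK). Qed.

(** Restricting to [u < v] makes each edge variable occur once, as orthogonality requires. *)
Lemma sum_sym (f : V -> V -> R) : (forall u, f u u = 0) -> (forall u v, f u v = f v u) ->
  \sum_u \sum_v f u v = 2 * \sum_(x : V * V | (x.1 < x.2)%N) f x.1 x.2.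
Proof.
move=> f0 fC; rewrite -(pair_big_dep xpredT (fun u v : V => (u < v)%N) f) /=.
have e u : \sum_v f u v = \sum_(v : V | (u < v)%N) f u v + \sum_(v : V | (v < u)%N) f u v.
  rewrite (bigID (fun v : V => (u < v)%N)) /=; congr (_ + _).
  rewrite (bigD1 u) ?ltnn //= f0 add0r; apply: eq_bigl => v.
  by rewrite -leqNgt ltn_neqAle andbC.
under eq_bigr => u _ do rewrite e.
rewrite big_split /= mulr2n mulrDl mul1r; congr (_ + _).
rewrite (exchange_big_dep xpredT) //=; apply: eq_bigr => u _.
by apply: eq_bigr => v _; rewrite fC.
Qed.

Lemma set2_lt_inj (u v u' v' : V) : (u < v)%N -> (u' < v')%N ->
  [set u; v]%SET = [set u'; v']%SET -> (u, v) = (u', v').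
Proof.
move=> uv uv' /setP h.
have := h u; have := h v; have := h u'; have := h v'.
rewrite !inE !eqxx ?orbT -!val_eqE /= => h1 h2 h3 h4.
by congr pair; apply: val_inj => /=; lia.
Qed.

(* The terms are orthogonal: a coefficient that does not vanish identically
   comes with an edge on which no coefficient depends. *)
Lemma Ex_pair_sum_sqr_le (g : V -> V -> {set {set V}} -> R) (c : R) :
  (forall u v J, `|g u v J| <= c) ->
  (forall u v, u != v -> (forall J, g u v J = 0) \/
     (forall u' v', dep_on (~: [set [set u; v]%SET]%SET) (g u' v'))) ->
  Ex P (fun J => (\sum_(x : V * V | (x.1 < x.2)%N) g x.1 x.2 J * cadj x.1 x.2 J) ^+ 2)
  <= c ^+ 2 * n%:R ^+ 2 * p.
Proof.
move=> gc gdep; have /andP[p0 p1] := p01.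
rewrite Ex_sqr_orthogonal; last first.
  case=> [u v] [u' v'] /= uv uv' neq.
  have nuv : u != v by rewrite neq_ltn uv.
  have nuv' : u' != v' by rewrite neq_ltn uv'.
  have nset : [set u'; v']%SET != [set u; v]%SET.
    by apply: contraNneq neq => /(set2_lt_inj uv' uv) ->.
  have [g0|gd] := gdep u v nuv.
    by rewrite (eq_Ex P (g := fun=> 0)) ?Ex_cst // => J; rewrite g0 !mul0r.
  rewrite (eq_Ex P (g := fun J => centered P [set u; v]%SET J *
     (g u v J * (g u' v' J * cadj u' v' J)))).
    apply: Ex_centered_mul0 => J K JK; rewrite (gd _ _ _ _ JK) (gd _ _ _ _ JK).
    by rewrite (dep_on_cadj _ JK) // !inE.
  by move=> J; rewrite cadjE //; ring.
have nn : \sum_(x : V * V) c ^+ 2 * p = c ^+ 2 * n%:R ^+ 2 * p.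
  by rewrite sumr_const card_prod card_ord -[LHS]mulr_natl natrM; ring.
rewrite -nn big_mkcond; apply: ler_sum => -[u v] _ /=.
have cp : 0 <= c ^+ 2 * p by rewrite mulr_ge0 ?sqr_ge0.
case: ifP => // _.
apply: le_trans (ler_wpM2l (sqr_ge0 c) (Ex_cadj_sqr_le u v)).
rewrite -ExZ; apply: le_Ex => // J; rewrite exprMn ler_wpM2r ?sqr_ge0 //.
rewrite -(real_normK (num_real (g u v J))) lerXn2r ?nnegrE //.
by apply: le_trans (gc u v J).
Qed.

(** Variance plus squared mean: the degree is a constant [b <= n p] plus orthogonal centered terms
    of variance at most [p] each. *)
Lemma Ex_deg_sqr_le v : Ex P (fun J => deg R J v ^+ 2) <= n%:R * p + (n%:R * p) ^+ 2.
Proof.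
have /andP[p0 p1] := p01.
pose b := \sum_(u : V) (u != v)%:R * p.
have degE J : deg R J v = b + \sum_u cadj u v J.
  by rewrite /b -big_split; apply: eq_bigr => u _ /=; rewrite adj_cadj.
have b0 : 0 <= b <= n%:R * p.
  rewrite sumr_ge0 => [/=|u _]; last by rewrite mulr_ge0.
  rewrite -[n]card_ord mulr_natl -sumr_const; apply: ler_sum => u _.
  by case: (u != v); rewrite ?mul1r ?mul0r.
have mean0 : Ex P (fun J => \sum_u cadj u v J) = 0.
  rewrite Ex_sum big1 // => u _; have [->|uv] := eqVneq u v.
    by rewrite (eq_Ex P (g := fun=> 0)) ?Ex_cst // => J; rewrite cadj_diag.
  rewrite -[RHS](Ex_centered P [set u; v]%SET); apply: eq_Ex => J.
  exact: cadjE.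
rewrite (eq_Ex P (g := fun J => b ^+ 2 + 2 * b * (\sum_u cadj u v J) + (\sum_u cadj u v J) ^+ 2)).
  rewrite !ExD Ex_cst ExZ mean0 mulr0 addr0 addrC lerD //; last first.
    by rewrite lerXn2r ?nnegrE ?mulr_ge0 //; case/andP: b0.
  rewrite Ex_sqr_orthogonal => [|u u' _ _ uu'].
    rewrite -[X in X%:R * p]card_ord mulr_natl -sumr_const.
    by apply: ler_sum => u _; apply: Ex_cadj_sqr_le.
  have [->|uv] := eqVneq u v.
    by rewrite (eq_Ex P (g := fun=> 0)) ?Ex_cst // => J; rewrite cadj_diag mul0r.
  rewrite (eq_Ex P (g := fun J => centered P [set u; v]%SET J * cadj u' v J)).
    apply/Ex_centered_mul0/dep_on_cadj => u'v; rewrite !inE.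
    apply: contra uu' => /eqP /setP /(_ u'); rewrite !inE eqxx (negPf u'v) !orbF /=.
    by move=> /esym; rewrite eq_sym.
  by move=> J; rewrite cadjE.
by move=> J; rewrite degE; ring.
Qed.

Lemma msize_cadj J :
  msize R J = p * (n%:R * (n%:R - 1) / 2) + \sum_(x : V * V | (x.1 < x.2)%N) cadj x.1 x.2 J.
Proof.
rewrite /msize; under eq_bigr => u _ do (under eq_bigr => v _ do rewrite adj_cadj).
under eq_bigr => u _ do rewrite big_split /= -mulr_suml.
rewrite big_split /= -mulr_suml (sum_sym (f := fun u v => cadj u v J)); last 2 first.
- by move=> u; rewrite cadj_diag.
- by move=> u v; rewrite cadjC.
have -> : \sum_(u : V) \sum_(v : V) (u != v)%:R = n%:R * (n%:R - 1) :> R.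
  rewrite -[X in X%:R * _]card_ord mulr_natl -sumr_const; apply: eq_bigr => u _.
  apply/eqP; rewrite eq_sym subr_eq -[X in X%:R]card_ord -sum1_card natr_sum.
  rewrite (bigD1 u) //= [X in _ == X + _](bigD1 u) //= eqxx add0r addrC; apply/eqP.
  by congr (_ + _); apply: eq_bigr => v vu; rewrite eq_sym vu.
by field.
Qed.

Lemma Ex_msize_deviation_le :
  Ex P (fun J => (msize R J - p * (n%:R * (n%:R - 1) / 2)) ^+ 2) <= n%:R ^+ 2 * p.
Proof.
have h := @Ex_pair_sum_sqr_le (fun _ _ _ => 1) 1.
rewrite expr1n mul1r in h; apply: le_trans (h _ _).
- rewrite le_eqVlt; apply/orP; left; apply/eqP/eq_Ex => J; congr (_ ^+ 2).
  by rewrite msize_cadj addrC addKr; apply: eq_bigr => x _; rewrite mul1r.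
- by move=> *; rewrite normr1.
- by move=> u v _; right => u' v' J K.
Qed.

End PairSums.

(** * The majority bipartition: gain and noise *)

Section SwapPartition.
Variables (R : realType) (n : nat) (p : R).
Hypothesis p01 : 0 <= p <= 1.
Local Notation V := 'I_n.
Local Notation P := (@edge_prob R n p).
Let P01 := edge_prob01 (n := n) p01.

(** [eps] is 1 and -1 on the two fixed sets and 0 elsewhere; [tau] exchanges the two sets and fixes
    all other vertices. *)
Variables (tau : V -> V) (eps : V -> R).
Hypothesis tauK : involutive tau.
Hypothesis eps_tau : forall v, eps (tau v) = - eps v.
Hypothesis tau_fix : forall v, eps v = 0 -> tau v = v.
Hypothesis eps_sqr : forall v, eps v ^+ 2 = (eps v != 0)%:R.

(* The vertices with eps v = 0 join the side of the fixed bipartition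
   [eps = 1], [eps = -1] in which they have more neighbours. *)
Definition bias (v : V) (J : {set {set V}}) : R := \sum_u eps u * adj R J u v.

(** The value 0 at ties keeps [lean] odd under the exchange of the two fixed sets. *)
Definition lean (v : V) (J : {set {set V}}) : R :=
  if eps v == 0 then Num.sg (bias v J) else 0.

Definition gain (J : {set {set V}}) : R := \sum_(v | eps v == 0) `|bias v J|.

Lemma sum_eps : \sum_v eps v = 0.
Proof.
have : \sum_v eps v = - \sum_v eps v.
  rewrite [LHS](reindex_inj (inv_inj tauK)) -sumrN.
  by apply: eq_bigr => v _; rewrite eps_tau.
lra.
Qed.

Lemma eps_norm_le1 v : `|eps v| <= 1.
Proof.
have := eps_sqr v; rewrite -(real_normK (num_real (eps v))) => h.
have : `|eps v| ^+ 2 <= 1 by rewrite h; case: (_ != _).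
by rewrite expr_le1.
Qed.

Lemma lean_norm_le1 v J : `|lean v J| <= 1.
Proof. by rewrite /lean; case: ifP; rewrite ?normr0 // normr_sg; case: (_ != _). Qed.

Lemma dep_on_bias (v : V) (F : {set {set V}}) : (forall u, eps u != 0 -> u != v -> [set u; v]%SET \in F) ->
  dep_on F (bias v).
Proof.
move=> hF J K JK; apply: eq_bigr => u _; have [->|u0] := eqVneq (eps u) 0.
  by rewrite !mul0r.
by congr (_ * _); apply: (dep_on_adj R _ JK) => uv; apply: hF.
Qed.

Lemma dep_on_lean (v : V) (F : {set {set V}}) :
  (eps v = 0 -> forall u, eps u != 0 -> u != v -> [set u; v]%SET \in F) ->
  dep_on F (lean v).
Proof.
move=> hF J K JK; rewrite /lean; case: eqP => // v0; congr Num.sg.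
exact: dep_on_bias (hF v0) _ _ JK.
Qed.

Lemma lean_bias v J : lean v J * bias v J = if eps v == 0 then `|bias v J| else 0.
Proof.
rewrite /lean; case: ifP => _; last by rewrite mul0r.
by rewrite mulrC [LHS]mulrC -normrEsg.
Qed.

Definition spins (J : {set {set V}}) (v : V) : R := eps v + lean v J.

Lemma spinsE J v : spins J v = if eps v == 0 then lean v J else eps v.
Proof.
rewrite /spins /lean; case: ifP => [/eqP->|_]; first by rewrite add0r.
by rewrite addr0.
Qed.

Lemma spins_bound J v : -1 <= spins J v <= 1.
Proof.
by rewrite -ler_norml spinsE; case: ifP => _; rewrite ?lean_norm_le1 ?eps_norm_le1.
Qed.

(** What remains of the product of two spins after the mixed terms [eps * lean], which produce the
    gain, are removed. *)
Definition same_side (u v : V) (J : {set {set V}}) : R :=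
  eps u * eps v + lean u J * lean v J.

Lemma same_side_cases u v J : same_side u v J =
  if (eps u == 0) && (eps v == 0) then lean u J * lean v J
  else eps u * eps v.
Proof.
rewrite /same_side /lean; case: eqP => [->|_]; case: eqP => [->|_] /=;
by rewrite ?mul0r ?mulr0 ?add0r ?addr0.
Qed.

Lemma same_side_norm_le1 u v J : `|same_side u v J| <= 1.
Proof.
rewrite same_side_cases; case: ifP => _; rewrite normrM -[leRHS]mulr1;
by rewrite ler_pM ?lean_norm_le1 ?eps_norm_le1.
Qed.

Definition side_noise (J : {set {set V}}) : R :=
  2 * \sum_(x : V * V | (x.1 < x.2)%N) same_side x.1 x.2 J * cadj p x.1 x.2 J.

(** The mixed terms give the gain twice. For the rest, the centered part is the noise and the mean
    part is [p] times a square minus at most [n] diagonal terms, because [eps] sums to 0. *)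
Lemma spins_adj_ge J :
  2 * gain J - n%:R * p + side_noise J <=
  \sum_u \sum_v adj R J u v * (spins J u * spins J v).
Proof.
have p0 : 0 <= p by case/andP: p01.
have e1 u v : adj R J u v * (spins J u * spins J v) =
    lean v J * (eps u * adj R J u v) + lean u J * (eps v * adj R J v u) +
    p * ((u != v)%:R * same_side u v J) + same_side u v J * cadj p u v J.
  rewrite /same_side /spins (adjC R J v u) (adj_cadj p); ring.
under eq_bigr => u _ do under eq_bigr => v _ do rewrite e1.
under eq_bigr => u _ do rewrite !big_split /=.
rewrite !big_split /=.
have g1 : \sum_u \sum_v lean u J * (eps v * adj R J v u) = gain J.
  rewrite /gain [RHS]big_mkcond; apply: eq_bigr => u _.
  by rewrite -mulr_sumr -/(bias u J) lean_bias.
have g2 : \sum_u \sum_v lean v J * (eps u * adj R J u v) = gain J.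
  by rewrite exchange_big.
rewrite g1 g2 (sum_sym (f := fun u v => same_side u v J * cadj p u v J)); last 2 first.
- by move=> u; rewrite cadj_diag mulr0.
- by move=> u v; rewrite cadjC /same_side; ring.
rewrite -/(side_noise J) lerD2r mulr2n mulrDl mul1r lerD2l.
under eq_bigr => u _ do rewrite -mulr_sumr.
rewrite -mulr_sumr (mulrC _ p) -mulrN ler_wpM2l //.
have -> : \sum_u \sum_v (u != v)%:R * same_side u v J =
    (\sum_u lean u J) ^+ 2 - \sum_u (eps u ^+ 2 + lean u J ^+ 2).
  have -> : (\sum_u lean u J) ^+ 2 = \sum_u \sum_v same_side u v J.
    transitivity ((\sum_u eps u) ^+ 2 + (\sum_u lean u J) ^+ 2).
      by rewrite sum_eps expr0n add0r.
    rewrite !expr2 !mulr_suml -big_split; apply: eq_bigr => u _ /=.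
    by rewrite !mulr_sumr -big_split.
  rewrite -sumrB; apply: eq_bigr => u _.
  rewrite (bigD1 u) //= [X in _ = X - _](bigD1 u) //= eqxx mul0r add0r.
  have -> : same_side u u J = eps u ^+ 2 + lean u J ^+ 2 by rewrite /same_side !expr2.
  rewrite [X in _ = X - _]addrC addrK.
  by apply: eq_bigr => v vu; rewrite eq_sym vu mul1r.
rewrite lerBrDr addrC -lerBrDr opprK; apply: (@le_trans _ _ n%:R); last first.
  by rewrite lerDr sqr_ge0.
rewrite -[X in _ <= X%:R]card_ord -sumr_const; apply: ler_sum => u _.
have := eps_sqr u; have := lean_norm_le1 u J; rewrite /lean.
case: eqP => [->|_] /= h ->; last by rewrite expr0n addr0.
by rewrite add0r -(real_normK (num_real _)) expr_le1.
Qed.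

(** The leans depend only on edges joining a vertex with [eps = 0] to one with [eps != 0]; an edge
    inside either class is none of these. *)
Lemma edge_neq_cross u v w x : u != v -> ((eps u == 0) = (eps v == 0)) ->
  eps w = 0 -> eps x != 0 -> [set x; w]%SET != [set u; v]%SET.
Proof.
move=> uv euv w0 x0; apply/eqP => /setP h.
have := h w; have := h x; rewrite !inE !eqxx ?orbT => /esym hx /esym hw.
have u0 : eps u == 0.
  by case/orP: hw => /eqP wE; [rewrite -wE w0 | rewrite euv -wE w0].
have v0 : eps v == 0 by rewrite -euv.
by case/orP: hx => /eqP xE; move: x0; rewrite xE ?u0 ?v0.
Qed.

(** For a pair inside one class the coefficients do not depend on its edge; for a mixed pair the
    coefficient is 0. Hence the bound for pair sums applies. *)
Lemma Ex_side_noise_sqr_le : Ex P (fun J => side_noise J ^+ 2) <= 4 * (n%:R ^+ 2 * p).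
Proof.
have h := @Ex_pair_sum_sqr_le R n p p01 same_side 1 same_side_norm_le1.
rewrite (eq_Ex P (g := fun J => 4 * (\sum_(x : V * V | (x.1 < x.2)%N)
  same_side x.1 x.2 J * cadj p x.1 x.2 J) ^+ 2)); last first.
  by move=> J; rewrite /side_noise; ring.
rewrite ExZ ler_pM2l //; move: h; rewrite expr1n mul1r; apply => u v uv.
have [euv|euv] := eqVneq (eps u == 0) (eps v == 0); [right|left].
  move=> u' v' J K JK; rewrite /same_side.
  have hc w : lean w J = lean w K.
    apply: (dep_on_lean _ JK) => w0 x x0 xw; rewrite !inE.
    exact: edge_neq_cross.
  by rewrite !hc.
move=> J; rewrite same_side_cases; move: euv.
by case: (eqVneq (eps u)) => [u0|_]; case: (eqVneq (eps v)) => [v0|_] //= _; rewrite ?u0 ?v0 ?mul0r ?mulr0.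
Qed.

Let supp : seq V := [seq u <- enum V | eps u != 0].
Let k : R := (#|[pred u | eps u != 0]|)%:R.

(** Centering the indicators costs nothing because [eps] sums to 0. *)
Lemma bias_linform v J : eps v = 0 ->
  bias v J = linform P eps (fun u => [set u; v]%SET) supp J.
Proof.
move=> v0; rewrite /linform big_filter big_enum_cond /=.
rewrite /bias (bigID (fun u => eps u != 0)) /= [X in _ + X]big1 ?addr0; last first.
  by move=> u; rewrite negbK => /eqP ->; rewrite mul0r.
transitivity (\sum_(u | eps u != 0) (eps u * p + eps u * centered P [set u; v]%SET J)).
  apply: eq_bigr => u u0; have uv : u != v by apply: contraNneq u0 => ->; rewrite v0.
  by rewrite (adj_cadj p) cadjE // uv mul1r mulrDr.
rewrite big_split /= -mulr_suml [X in X * p](_ : _ = 0) ?mul0r ?add0r //.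
rewrite -[RHS]sum_eps [RHS](bigID (fun u => eps u != 0)) /= [X in _ = _ + X]big1 ?addr0 //.
by move=> u; rewrite negbK => /eqP.
Qed.

Lemma uniq_supp_edges v : eps v = 0 -> uniq [seq [set u; v]%SET | u <- supp].
Proof.
move=> v0; rewrite map_inj_in_uniq => [|x y]; first exact/filter_uniq/enum_uniq.
rewrite !mem_filter => /andP[x0 _] /andP[y0 _] /setP /(_ x).
rewrite !inE eqxx /= => /esym/orP[/eqP //|/eqP xv].
by move: x0; rewrite xv v0 eqxx.
Qed.

Lemma Ex_bias_sqr v : eps v = 0 -> Ex P (fun J => bias v J ^+ 2) = k * (p * (1 - p)).
Proof.
move=> v0; rewrite (eq_Ex P (g := fun J => linform P eps (fun u => [set u; v]%SET) supp J ^+ 2)).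
  rewrite (Ex_linform_sqr _ _ (uniq_supp_edges v0)) big_filter big_enum_cond /=.
  rewrite (eq_bigr (fun=> p * (1 - p))) => [|u u0]; last first.
    have uv : u != v by apply: contraNneq u0 => ->; rewrite v0.
    by rewrite eps_sqr u0 /edge_prob inE cards2 uv mul1r.
  by rewrite sumr_const mulr_natl.
by move=> J; rewrite bias_linform.
Qed.

Lemma Ex_bias_exp4_le v : eps v = 0 -> Ex P (fun J => bias v J ^+ 4) <=
  3 * (k * (p * (1 - p))) ^+ 2 + k * (p * (1 - p)).
Proof.
move=> v0.
have e m : Ex P (fun J => bias v J ^+ m) =
    Ex P (fun J => linform P eps (fun u => [set u; v]%SET) supp J ^+ m).
  by apply: eq_Ex => J; rewrite bias_linform.
rewrite -(Ex_bias_sqr v0) !e; apply: (Ex_linform_exp4 P01 (uniq_supp_edges v0)) => u _.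
by rewrite eps_sqr; case: (_ != _).
Qed.

(** Biases of distinct vertices use disjoint sets of edges, so variances add, and the variance of an
    absolute value is at most its second moment. *)
Lemma Ex_gain_deviation_le :
  Ex P (fun J => (gain J - Ex P gain) ^+ 2) <= n%:R * (k * (p * (1 - p))).
Proof.
have kv0 : 0 <= k * (p * (1 - p)).
  by have /andP[p0 p1] := p01; rewrite !mulr_ge0 // subr_ge0.
have -> : Ex P gain = \sum_(v | eps v == 0) Ex P (fun J => `|bias v J|) by rewrite /gain Ex_sum.
rewrite (eq_Ex P (g := fun J =>
   (\sum_(v | eps v == 0) (`|bias v J| - Ex P (fun K => `|bias v K|))) ^+ 2)); last first.
  by move=> J; rewrite sumrB.
rewrite Ex_sqr_orthogonal => [|v w v0 w0 vw].
  rewrite -[n in n%:R]card_ord mulr_natl -sumr_const big_mkcond; apply: ler_sum => v _.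
  case: ifP => // /eqP v0; rewrite -(Ex_bias_sqr v0).
  set c := Ex P (fun K => `|bias v K|).
  rewrite (eq_Ex P (g := fun J => bias v J ^+ 2 - (2 * c) * `|bias v J| + c ^+ 2)); last first.
    by move=> J; rewrite -(real_normK (num_real (bias v J))); ring.
  by rewrite ExD ExB ExZ Ex_cst -/c; have := sqr_ge0 c; lra.
have mean0 (u : V) : Ex P (fun J => `|bias u J| - Ex P (fun K => `|bias u K|)) = 0.
  by rewrite ExB Ex_cst subrr.
rewrite (@Ex_indep _ _ _ [set e : {set V} | v \in e]%SET) ?mean0 ?mul0r //.
- move=> J K JK; congr (`|_| - _); apply: dep_on_bias JK => u u0 uv.
  by rewrite !inE eqxx orbT.
- move=> J K JK; congr (`|_| - _); apply: dep_on_bias JK => u u0 uv.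
  rewrite !inE negb_or vw andbT; apply: contraNneq u0 => <-; exact: v0.
Qed.

(** [q] is the standard deviation of each bias, and the condition on [K] puts the fourth moment
    bound into the form needed for the first absolute moment. *)
Lemma Ex_gain_ge (q K : R) : 0 < q -> 1 <= K -> q ^+ 2 = k * (p * (1 - p)) ->
  3 * q ^+ 4 + q ^+ 2 <= K * q ^+ 4 ->
  (#|[pred v | eps v == 0]|)%:R * q <= 4 * K * Ex P gain.
Proof.
move=> q0 K1 qE hK; rewrite /gain Ex_sum mulr_sumr mulr_natl -sumr_const.
apply: ler_sum => v /eqP v0; apply: Ex_abs_ge => //; first by rewrite Ex_bias_sqr.
apply: le_trans (Ex_bias_exp4_le v0) _; rewrite -qE; apply: le_trans hK.
by rewrite -exprM.
Qed.

End SwapPartition.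

(** * The volume difference of the two sides *)

Section Volume.
Variables (R : realType) (n : nat) (p : R).
Hypothesis p01 : 0 <= p <= 1.
Local Notation V := 'I_n.
Local Notation P := (@edge_prob R n p).
Implicit Types (u v w x y : V) (J : {set {set V}}).
Let P01 := edge_prob01 (n := n) p01.

Variables (tau : V -> V) (eps : V -> R).
Hypothesis tauK : involutive tau.
Hypothesis eps_tau : forall v, eps (tau v) = - eps v.
Hypothesis tau_fix : forall v, eps v = 0 -> tau v = v.
Hypothesis eps_sqr : forall v, eps v ^+ 2 = (eps v != 0)%:R.

(** For [eps w = 0] this is a probability-preserving involution which reverses the bias of [w], but
    keeps all other biases and the degrees of all vertices with [eps = 0]. *)
Definition swap_at (w : V) (e : {set V}) : {set V} :=
  if w \in e then (tau @: e)%SET else e.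

Section SwapAt.
Variable w : V.
Hypothesis w0 : eps w = 0.

Lemma mem_tau_imset (e : {set V}) : (w \in (tau @: e)%SET) = (w \in e).
Proof. by rewrite -{1}(tau_fix w0) mem_imset //; apply: inv_inj. Qed.

Lemma swap_atK : involutive (swap_at w).
Proof.
move=> e; rewrite /swap_at; case we: (w \in e); last by rewrite we.
rewrite mem_tau_imset we -imset_comp -[RHS]imset_id; apply: eq_imset => v.
exact: tauK.
Qed.

Lemma edge_prob_swap_at e : P (swap_at w e) = P e.
Proof.
rewrite /swap_at; case: ifP => // _.
by rewrite /edge_prob !inE card_imset //; apply: inv_inj.
Qed.

Lemma adj_swap_at x (J : {set {set V}}) : adj R (swap_at w @^-1: J)%SET x w = adj R J (tau x) w.
Proof.
rewrite /adj inE /swap_at !inE eqxx orbT imsetU1 imset_set1 (tau_fix w0).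
suff -> : (tau x == w) = (x == w) by [].
by rewrite -{1}(tau_fix w0) (inj_eq (inv_inj tauK)).
Qed.

Lemma adj_swap_at_neq x y J : x != w -> y != w ->
  adj R (swap_at w @^-1: J)%SET x y = adj R J x y.
Proof.
by move=> xw yw; rewrite /adj inE /swap_at !inE !(eq_sym w) (negPf xw) (negPf yw).
Qed.

Lemma bias_swap_at J : bias eps w (swap_at w @^-1: J)%SET = - bias eps w J.
Proof.
rewrite /bias -sumrN (reindex_inj (inv_inj tauK)); apply: eq_bigr => u _.
by rewrite adj_swap_at tauK eps_tau mulNr.
Qed.

(** At [w] the neighbours are permuted by [tau]; at another such vertex the only edge concerned is
    the one to [w], and [tau] fixes both its ends. *)
Lemma deg_swap_at v J : eps v = 0 -> deg R (swap_at w @^-1: J)%SET v = deg R J v.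
Proof.
move=> v0; rewrite /deg; have [->|vw] := eqVneq v w.
  rewrite [RHS](reindex_inj (inv_inj tauK)).
  by apply: eq_bigr => u _; rewrite adj_swap_at.
apply: eq_bigr => u _; have [->|uw] := eqVneq u w; last exact: adj_swap_at_neq.
by rewrite adjC adj_swap_at (tau_fix v0) adjC.
Qed.

Lemma bias_swap_at_neq v J : v != w ->
  bias eps v (swap_at w @^-1: J)%SET = bias eps v J.
Proof.
move=> vw; apply: eq_bigr => u _; have [->|uw] := eqVneq u w.
  by rewrite w0 !mul0r.
by rewrite adj_swap_at_neq.
Qed.

End SwapAt.

(** The swap at [u] changes the sign of the product and preserves the measure, so the expectation
    equals its own negative. *)
Lemma Ex_lean_deg_orthogonal u v : u != v ->
  Ex P (fun J => (lean eps u J * deg R J u) * (lean eps v J * deg R J v)) = 0.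
Proof.
move=> uv; have [u0|u0] := eqVneq (eps u) 0; last first.
  rewrite (eq_Ex P (g := fun=> 0)) ?Ex_cst // => J.
  by rewrite /lean (negPf u0) !mul0r.
have [v0|v0] := eqVneq (eps v) 0; last first.
  rewrite (eq_Ex P (g := fun=> 0)) ?Ex_cst // => J.
  by rewrite /lean (negPf v0) mul0r mulr0.
set f := fun J : {set {set V}} => _.
have : Ex P f = - Ex P f.
  rewrite -{1}(Ex_preim f (swap_atK u0) (edge_prob_swap_at u)) -ExN.
  apply: eq_Ex => J; rewrite /f /lean u0 v0 eqxx !deg_swap_at //.
  by rewrite bias_swap_at // bias_swap_at_neq 1?eq_sym // sgrN; ring.
lra.
Qed.

Definition imbalance (J : {set {set V}}) : R := \sum_v spins eps J v * deg R J v.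

(** All mean degrees agree, so they cancel against [eps]; symmetrizing collects the two ends of each
    edge. *)
Lemma eps_deg J : \sum_v eps v * deg R J v =
  \sum_(x : V * V | (x.1 < x.2)%N) (eps x.1 + eps x.2) * cadj p x.1 x.2 J.
Proof.
have e1 : \sum_v eps v * deg R J v = \sum_v \sum_u eps v * cadj p u v J.
  transitivity (\sum_v (eps v * (\sum_(u : V) (u != v)%:R * p) + \sum_u eps v * cadj p u v J)).
    apply: eq_bigr => v _; rewrite mulr_sumr mulr_sumr -big_split; apply: eq_bigr => u _ /=.
    by rewrite (adj_cadj p) mulrDr.
  rewrite big_split /= [X in X + _](_ : _ = 0) ?add0r //.
  transitivity (\sum_v eps v * ((n%:R - 1) * p)).
    apply: eq_bigr => v _; congr (_ * _); rewrite -mulr_suml; congr (_ * _).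
    rewrite (bigD1 v) //= eqxx add0r -[in n%:R](card_ord n) -sum1_card natr_sum.
    rewrite [X in _ = X - 1](bigD1 v) //= addrC addrK.
    by apply: eq_bigr => u ->.
  by rewrite -mulr_suml (sum_eps tauK) // mul0r.
have e2 : \sum_v eps v * deg R J v = \sum_v \sum_u eps u * cadj p u v J.
  by rewrite e1 exchange_big; apply: eq_bigr => u _; apply: eq_bigr => v _; rewrite cadjC.
have : 2 * \sum_v eps v * deg R J v = \sum_v \sum_u (eps v + eps u) * cadj p v u J.
  rewrite mulr2n mulrDl mul1r {1}e1 e2 -big_split; apply: eq_bigr => u _ /=.
  by rewrite -big_split; apply: eq_bigr => v _ /=; rewrite mulrDl (cadjC p u v).
rewrite (sum_sym (f := fun u v => (eps u + eps v) * cadj p u v J)).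
- by move/mulfI; apply; rewrite pnatr_eq0.
- by move=> u; rewrite cadj_diag mulr0.
- by move=> u v; rewrite cadjC addrC.
Qed.

(** The part from [eps] is a pair sum with coefficients at most 2; the part from [lean] has
    orthogonal terms bounded by squared degrees. *)
Lemma Ex_imbalance_sqr_le : Ex P (fun J => imbalance J ^+ 2) <=
  2 * (4 * n%:R ^+ 2 * p) + 2 * (n%:R * (n%:R * p + (n%:R * p) ^+ 2)).
Proof.
pose f J := \sum_v eps v * deg R J v; pose g J := \sum_v lean eps v J * deg R J v.
apply: (@le_trans _ _ (Ex P (fun J => 2 * f J ^+ 2 + 2 * g J ^+ 2))).
  apply: le_Ex => // J.
  have -> : imbalance J = f J + g J.
    by rewrite /f /g -big_split; apply: eq_bigr => v _ /=; rewrite -mulrDl.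
  have := sqr_ge0 (f J - g J); nra.
rewrite ExD !ExZ; apply: lerD; rewrite ler_pM2l //.
  have -> : 4 = 2 ^+ 2 :> R by ring.
  rewrite (eq_Ex P (g := fun J =>
     (\sum_(x : V * V | (x.1 < x.2)%N) (eps x.1 + eps x.2) * cadj p x.1 x.2 J) ^+ 2)); last first.
    by move=> J; rewrite /f eps_deg.
  apply: (Ex_pair_sum_sqr_le p01 (g := fun u v _ => eps u + eps v)) => [u v J|u v uv].
    apply: le_trans (ler_normD _ _) _.
    have := eps_norm_le1 eps_sqr u; have := eps_norm_le1 eps_sqr v; lra.
  by right => u' v' J K.
rewrite Ex_sqr_orthogonal => [|u v _ _ uv]; last exact: Ex_lean_deg_orthogonal.
rewrite -[X in X%:R * (_ + _)]card_ord [leRHS]mulr_natl -sumr_const; apply: ler_sum => v _.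
apply: le_trans (Ex_deg_sqr_le p01 v); apply: le_Ex => // J.
rewrite exprMn ler_piMl ?sqr_ge0 // -(real_normK (num_real _)) expr_le1 //.
exact: lean_norm_le1.
Qed.

Lemma modform_spins_ge J : 0 < msize R J ->
  2 * gain eps J - n%:R * p + side_noise p eps J - imbalance J ^+ 2 / (2 * msize R J) <=
  modform J (spins eps J).
Proof.
move=> m0.
have -> : modform J (spins eps J) = \sum_u \sum_v adj R J u v * (spins eps J u * spins eps J v) -
    imbalance J ^+ 2 / (2 * msize R J).
  have -> : imbalance J ^+ 2 / (2 * msize R J) =
      \sum_u \sum_v deg R J u * deg R J v / (2 * msize R J) * (spins eps J u * spins eps J v).
    rewrite expr2 {1}/imbalance !mulr_suml; apply: eq_bigr => u _.
    rewrite /imbalance -mulrA mulr_suml mulr_sumr; apply: eq_bigr => v _; ring.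
  rewrite -sumrB; apply: eq_bigr => u _; rewrite -sumrB; apply: eq_bigr => v _.
  by rewrite -mulrBl.
by rewrite lerD2r (spins_adj_ge p01 tauK).
Qed.

End Volume.

(** * The lower bound: concrete sets, constants and error events *)

Section LowerBound.
Variable R : realType.

Definition half_sign n (v : 'I_n) : R :=
  if (v < n %/ 4)%N then 1 else if (v < n %/ 4 + n %/ 4)%N then -1 else 0.

(** The value is always in range, so the default of [insubd] is never taken. *)
Definition half_swap n (v : 'I_n) : 'I_n :=
  insubd v (if (v < n %/ 4)%N then v + n %/ 4
            else if (v < n %/ 4 + n %/ 4)%N then v - n %/ 4 else v)%N.

Lemma val_half_swap n (v : 'I_n) : val (half_swap v) =
  (if (v < n %/ 4)%N then v + n %/ 4
   else if (v < n %/ 4 + n %/ 4)%N then v - n %/ 4 else v)%N.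
Proof.
rewrite val_insubd; case: ifP => // /negP; case: v => v vn /= []; move: vn.
by do ?case: ifP => /=; lia.
Qed.

Lemma half_swapK n : involutive (@half_swap n).
Proof.
move=> v; apply: val_inj; rewrite !val_half_swap /=; case: v => v vn /=.
by do !case: ifP => /=; lia.
Qed.

Lemma half_sign_swap n (v : 'I_n) : half_sign (half_swap v) = - half_sign v.
Proof.
rewrite /half_sign val_half_swap; case: v => v vn /=.
have [v1|v1] := ltnP v (n %/ 4).
  by rewrite ltnNge leq_addl /= ltn_add2r v1.
have [v2|v2] := ltnP v (n %/ 4 + n %/ 4); last first.
  by rewrite !ltnNge v1 v2 oppr0.
by rewrite ltn_subLR // v2 opprK.
Qed.

Lemma half_sign_eq0 n (v : 'I_n) : (half_sign v == 0) = ~~ (v < n %/ 4 + n %/ 4)%N.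
Proof.
rewrite /half_sign; case: ltnP => [v1|v1].
  by rewrite oner_eq0 (leq_trans v1) // leq_addr.
by case: ifP => _; rewrite ?oppr_eq0 ?oner_eq0 ?eqxx.
Qed.

Lemma half_swap_fix n (v : 'I_n) : half_sign v = 0 -> half_swap v = v.
Proof.
move/eqP; rewrite half_sign_eq0 => v2; apply: val_inj; rewrite val_half_swap (negPf v2).
by case: ifP => // v1; lia.
Qed.

Lemma half_sign_sqr n (v : 'I_n) : half_sign v ^+ 2 = (half_sign v != 0)%:R.
Proof.
rewrite half_sign_eq0 negbK /half_sign; case: ltnP => [v1|v1].
  by rewrite expr1n (leq_trans v1) // leq_addr.
by case: ifP => _; rewrite ?sqrrN ?expr1n ?expr0n.
Qed.

Lemma card_ord_lt n m : (m <= n)%N -> #|[pred v : 'I_n | (v < m)%N]| = m.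
Proof.
move=> mn; rewrite -sum1_card -(big_ord_widen n (fun=> 1%N) mn).
by rewrite sum_nat_const card_ord muln1.
Qed.

Lemma card_half_sign_neq0 n : #|[pred v : 'I_n | half_sign v != 0]| = (n %/ 4 + n %/ 4)%N.
Proof.
rewrite -[RHS](@card_ord_lt n); last by lia.
by apply: eq_card => v; rewrite !inE half_sign_eq0 negbK.
Qed.

Lemma card_half_sign_eq0 n :
  #|[pred v : 'I_n | half_sign v == 0]| = (n - (n %/ 4 + n %/ 4))%N.
Proof.
have := cardC [pred v : 'I_n | half_sign v != 0]; rewrite card_half_sign_neq0 card_ord.
rewrite (eq_card (B := [pred v : 'I_n | half_sign v == 0])); last first.
  by move=> v; rewrite !inE negbK.
by move=> h; apply/eqP; rewrite eq_sym -(eqn_add2l (n %/ 4 + n %/ 4)) h subnKC //; lia.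
Qed.

Lemma modularity_gt_of_swap n (p d eta c mu : R) (tau : 'I_n -> 'I_n) (eps : 'I_n -> R)
    (G : sgraph 'I_n) (J := edges G) :
  0 <= p <= 1 -> involutive tau ->
  (forall v, eps (tau v) = - eps v) -> (forall v, eps v ^+ 2 = (eps v != 0)%:R) ->
  (2 <= n)%N -> 1 <= d -> d ^+ 2 = n%:R * p -> 0 < eta -> 12 * eta <= c -> d <= eta * n%:R ->
  c * (n%:R * d) <= mu -> `|gain eps J - mu| < eta * (n%:R * d) ->
  `|side_noise p eps J| < eta * (n%:R * d) ->
  imbalance eps J ^+ 2 < eta * (n%:R ^+ 2 * d ^+ 3) ->
  \sum_v deg R J v ^+ 2 < eta * (n%:R ^+ 2 * d ^+ 3) ->
  `|msize R J - p * (n%:R * (n%:R - 1) / 2)| < n%:R * d ^+ 2 / 8 ->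
  c / 8 / d < modularity R G.
Proof.
move=> p01 tauK epsT epsS n2 d1 dE eta0 etac dn cmu.
rewrite !ltr_norml => /andP[hM _] /andP[hN _] hI hD /andP[hm1 hm2].
have N2 : 2 <= n%:R :> R by rewrite ler_nat.
have d0 : 0 < d by lra.
have e1 : p * (n%:R * (n%:R - 1) / 2) = d ^+ 2 * (n%:R - 1) / 2 by rewrite dE; ring.
rewrite e1 in hm1 hm2.
have d20 : 0 < d ^+ 2 by rewrite exprn_gt0.
have nd2 : 2 * d ^+ 2 <= n%:R * d ^+ 2 by rewrite ler_pM2r.
set m := msize R J in hm1 hm2 *.
have m1 : n%:R * d ^+ 2 / 8 <= m by lra.
have m2 : m <= n%:R * d ^+ 2 by lra.
have m0 : 0 < m by apply: lt_le_trans m1; lra.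
have mG : num_edges G != 0%N by move: m0; rewrite /m msize_num_edges ltr0n lt0n.
set L := n%:R * d in cmu hM hN.
have L0 : 0 < L by rewrite mulr_gt0 //; lra.
have bound x : x < eta * (n%:R ^+ 2 * d ^+ 3) -> x / (2 * m) <= 4 * eta * L.
  have mm : 0 < 2 * m by apply: mulr_gt0.
  move=> hx; rewrite ler_pdivrMr //; apply: le_trans (ltW hx) _.
  have -> : eta * (n%:R ^+ 2 * d ^+ 3) = 8 * (eta * L) * (n%:R * d ^+ 2 / 8).
    by rewrite /L; field.
  have -> : 4 * eta * L * (2 * m) = 8 * (eta * L) * m by ring.
  by rewrite ler_pM2l // pmulr_rgt0 // mulr_gt0.
have pn : n%:R * p <= eta * L.
  by rewrite -dE expr2 /L mulrA ler_pM2r.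
have Q := modform_spins_ge p01 tauK epsT epsS m0.
have [S hS] := exists_spin_ge_frac J (spins_bound epsS J).
(* The form is at least [2 mu] minus [12 eta L]: 2 from the gain, 1 each from [n p] and the noise, 4
   each from imbalance and rounding. This explains [12 * eta <= c]. *)
have q4 : c * L <= 4 * m * modularity R G.
  apply: le_trans (modularity_ge_spin _ S mG); apply: le_trans hS.
  have := bound _ hI; have := bound _ hD; rewrite -/m in Q *.
  have cL : 12 * eta * L <= c * L by rewrite ler_pM2r.
  have muL : c * L <= mu by [].
  lra.
have c0 : 0 < c by apply: lt_le_trans etac; rewrite mulr_gt0.
(* Positivity allows [m] to be replaced by its upper bound [n d^2], which yields [c / (4 d)]; the
   constant 8 leaves room for strictness. *)
have q0 : 0 < modularity R G.
  have mm : 0 < 4 * m by apply: mulr_gt0.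
  by rewrite -(pmulr_rgt0 _ mm); apply: lt_le_trans q4; rewrite mulr_gt0.
have q4' : c * L <= 4 * (n%:R * d ^+ 2) * modularity R G.
  apply: le_trans q4 _; rewrite ler_pM2r // ler_pM2l //.
rewrite ltr_pdivrMr // -(ltr_pM2r L0).
apply: (@lt_le_trans _ _ (c * L / 4)); first by have := mulr_gt0 c0 L0; lra.
rewrite ler_pdivrMr //; apply: le_trans q4' _.
by rewrite le_eqVlt; apply/orP; left; apply/eqP; rewrite /L; ring.
Qed.

Lemma Ex_gain_half_ge n (p e d : R) : 0 <= p <= 1 -> (9 <= n)%N -> 0 < e <= 1 ->
  p <= 1 - e -> 1 <= d -> d ^+ 2 = n%:R * p ->
  Num.sqrt (e / 3) / (8 * (3 + 3 / e)) * (n%:R * d) <=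
  Ex (edge_prob p) (gain (@half_sign n)).
Proof.
move=> /andP[p0 p1] n9 /andP[e0 e1] pe d1 dE.
have d0 : 0 < d by lra.
set k := #|[pred u : 'I_n | half_sign u != 0]|%:R : R.
(* The two fixed sets have [n %/ 4] vertices each; [9 <= n] absorbs the rounding down. *)
have kn : n%:R / 3 <= k.
  by rewrite /k card_half_sign_neq0 ler_pdivrMr // -natrM ler_nat; lia.
have wn : n%:R / 2 <= #|[pred u : 'I_n | half_sign u == 0]|%:R :> R.
  by rewrite card_half_sign_eq0 ler_pdivrMr // -natrM ler_nat; lia.
have kv : e / 3 * d ^+ 2 <= k * (p * (1 - p)).
  rewrite dE (_ : e / 3 * (n%:R * p) = n%:R / 3 * (p * e)); last by field.
  by apply: ler_pM; rewrite ?divr_ge0 ?mulr_ge0 ?ler_wpM2l //; lra.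
have e30 : 0 < e / 3 by rewrite divr_gt0.
have kv0 : 0 < k * (p * (1 - p)) by apply: lt_le_trans kv; rewrite mulr_gt0 ?exprn_gt0.
set q := Num.sqrt (k * (p * (1 - p))).
have q0 : 0 < q by rewrite sqrtr_gt0.
have qE : q ^+ 2 = k * (p * (1 - p)) by rewrite sqr_sqrtr // ltW.
set s := Num.sqrt (e / 3).
have s0 : 0 < s by rewrite sqrtr_gt0.
have sE : s ^+ 2 = e / 3 by rewrite sqr_sqrtr // ltW.
have sd0 : 0 <= s * d by rewrite mulr_ge0 // ltW.
have sq : s * d <= q.
  by rewrite -(ler_pXn2r (n := 2)) ?nnegrE ?(ltW q0) // exprMn qE sE.
(* The variance satisfies [q^2 >= e / 3] since [d >= 1], so [q^2 <= (3 / e) q^4]. *)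
set K := 3 + 3 / e.
have e3 : 0 < 3 / e by rewrite divr_gt0.
have K1 : 1 <= K by rewrite /K; lra.
have hK : 3 * q ^+ 4 + q ^+ 2 <= K * q ^+ 4.
  have -> : K * q ^+ 4 = 3 * q ^+ 4 + 3 / e * q ^+ 4 by rewrite /K mulrDl.
  rewrite lerD2l.
  have eq2 : 1 <= 3 / e * q ^+ 2.
    rewrite -(ler_pM2l e30) mulr1 mulrA.
    have -> : e / 3 * (3 / e) = 1 by field; rewrite gt_eqF.
    rewrite mul1r qE; apply: le_trans kv; rewrite ler_peMr ?(ltW e30) //.
    by rewrite expr_ge1 // ltW.
  have -> : 3 / e * q ^+ 4 = 3 / e * q ^+ 2 * q ^+ 2 by ring.
  by rewrite ler_peMl // ltW // exprn_gt0.
have p01 : 0 <= p <= 1 by rewrite p0.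
have := Ex_gain_ge p01 (@half_swapK n) (@half_sign_swap n) (@half_sign_sqr n) q0 K1 qE hK.
set E := Ex _ _ => hE.
have K0 : 0 < 8 * K by rewrite mulr_gt0 //; lra.
rewrite mulrAC ler_pdivrMr //.
have : n%:R / 2 * (s * d) <= #|[pred u : 'I_n | half_sign u == 0]|%:R * q.
  by apply: ler_pM; rewrite ?divr_ge0.
move/le_trans => /(_ _ hE); lra.
Qed.

(** Union of five bad events. Chebyshev gives [4 / eta^2], [1 / eta^2] and 64 over [n], Markov gives
    [12 / eta] and [2 / eta] times [d / n]; as [d <= sqrt n], all are of order [1 / sqrt n]. *)
Lemma modularity_lower_prob n (p d eta c : R) : 0 <= p <= 1 -> (2 <= n)%N -> 1 <= d ->
  d ^+ 2 = n%:R * p -> 0 < eta -> 12 * eta <= c -> d <= eta * n%:R ->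
  c * (n%:R * d) <= Ex (edge_prob p) (gain (@half_sign n)) ->
  1 - (5 / eta ^+ 2 + 14 / eta + 64) / Num.sqrt n%:R <=
  gnp_prob p (fun G : sgraph 'I_n => c / 8 / d < modularity R G).
Proof.
move=> p01 n2 d1 dE eta0 etac dn cmu; have P01 := edge_prob01 (n := n) p01.
have /andP[p0 p1] := p01.
pose P := @edge_prob R n p; pose eps := @half_sign n.
set mu := Ex _ _ in cmu.
pose B1 (J : {set {set 'I_n}}) := eta * (n%:R * d) <= `|side_noise p eps J|.
pose B2 (J : {set {set 'I_n}}) := eta * (n%:R * d) <= `|gain eps J - mu|.
pose B3 (J : {set {set 'I_n}}) := eta * (n%:R ^+ 2 * d ^+ 3) <= imbalance eps J ^+ 2.
pose B4 (J : {set {set 'I_n}}) := eta * (n%:R ^+ 2 * d ^+ 3) <= \sum_v deg R J v ^+ 2.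
pose B5 (J : {set {set 'I_n}}) := n%:R * d ^+ 2 / 8 <= `|msize R J - p * (n%:R * (n%:R - 1) / 2)|.
apply: le_trans (gnp_prob_ge p01
  (B := fun J => B1 J || (B2 J || (B3 J || (B4 J || B5 J)))) _); last first.
  move=> G; rewrite !negb_or -!ltNge => /and5P[b1 b2 b3 b4 b5].
  exact: (modularity_gt_of_swap p01 (@half_swapK n) (@half_sign_swap n)
    (@half_sign_sqr n) n2 d1 dE eta0 etac dn cmu).
have N2 : 2 <= n%:R :> R by rewrite ler_nat.
have N0 : 0 < n%:R :> R by lra.
have d0 : 0 < d by lra.
have Nd : 0 < n%:R * d by rewrite mulr_gt0.
have pE : p = d ^+ 2 / n%:R by rewrite dE mulrC mulKf // gt_eqF.
have d2 : 1 <= d ^+ 2 by rewrite expr_ge1 // ltW.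
have h1 : Pr P B1 <= 4 / eta ^+ 2 / n%:R.
  apply: le_trans (Pr_chebyshev P01 (f := side_noise p eps) (t := eta * (n%:R * d)) _ _) _ => //.
    by rewrite mulr_gt0.
  rewrite ler_pdivrMr ?exprn_gt0 ?mulr_gt0 //.
  apply: le_trans (Ex_side_noise_sqr_le p01 (@half_sign_sqr n)) _.
  rewrite le_eqVlt; apply/orP; left; apply/eqP; rewrite [in LHS]pE.
  by field; rewrite !gt_eqF.
have h2 : Pr P B2 <= 1 / eta ^+ 2 / n%:R.
  apply: le_trans (Pr_chebyshev P01 (f := fun J => gain eps J - mu) (t := eta * (n%:R * d)) _ _) _ => //.
    by rewrite mulr_gt0.
  rewrite ler_pdivrMr ?exprn_gt0 ?mulr_gt0 //.
  apply: le_trans (Ex_gain_deviation_le p01 (@half_swapK n) (@half_sign_swap n) (@half_sign_sqr n)) _.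
  apply: (@le_trans _ _ (n%:R * (n%:R * p))).
    rewrite ler_pM2l //; apply: ler_pM; rewrite ?mulr_ge0 ?subr_ge0 //.
      by rewrite ler_nat -[leqRHS]card_ord max_card.
    by rewrite ler_piMr // gerBl.
  rewrite le_eqVlt; apply/orP; left; apply/eqP; rewrite [in LHS]pE.
  by field; rewrite !gt_eqF.
have d4 : d ^+ 2 <= d ^+ 4.
  have -> : d ^+ 4 = d ^+ 2 * d ^+ 2 by ring.
  by rewrite ler_peMr // ltW // exprn_gt0.
have nd4 : n%:R * d ^+ 2 <= n%:R * d ^+ 4 by rewrite ler_pM2l.
have pos3 : 0 < eta * (n%:R ^+ 2 * d ^+ 3) by rewrite !mulr_gt0 ?exprn_gt0.
have h3 : Pr P B3 <= 12 / eta * (d / n%:R).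
  apply: le_trans (Pr_markov P01 (f := fun J => imbalance eps J ^+ 2) pos3 _ _) _ => //.
    by move=> J; rewrite sqr_ge0.
  rewrite ler_pdivrMr //.
  apply: le_trans (Ex_imbalance_sqr_le p01 (@half_swapK n) (@half_sign_swap n)
    (@half_swap_fix n) (@half_sign_sqr n)) _.
  have -> : 12 / eta * (d / n%:R) * (eta * (n%:R ^+ 2 * d ^+ 3)) = 12 * (n%:R * d ^+ 4).
    by field; rewrite !gt_eqF.
  rewrite -dE.
  have -> : 2 * (4 * n%:R ^+ 2 * p) + 2 * (n%:R * (d ^+ 2 + d ^+ 2 ^+ 2)) =
     10 * (n%:R * d ^+ 2) + 2 * (n%:R * d ^+ 4).
    by rewrite [in LHS]pE; field; rewrite gt_eqF.
  lra.
have h4 : Pr P B4 <= 2 / eta * (d / n%:R).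
  apply: le_trans (Pr_markov P01 (f := fun J => \sum_v deg R J v ^+ 2) pos3 _ _) _ => //.
    by move=> J; rewrite sumr_ge0 // => v _; rewrite sqr_ge0.
  rewrite ler_pdivrMr // Ex_sum.
  apply: le_trans (ler_sum _ (fun v _ => Ex_deg_sqr_le p01 v)) _.
  rewrite sumr_const card_ord -[leLHS]mulr_natl -dE.
  have -> : 2 / eta * (d / n%:R) * (eta * (n%:R ^+ 2 * d ^+ 3)) = 2 * (n%:R * d ^+ 4).
    by field; rewrite !gt_eqF.
  have -> : n%:R * (d ^+ 2 + d ^+ 2 ^+ 2) = n%:R * d ^+ 2 + n%:R * d ^+ 4 by ring.
  lra.
have nd8 : 0 < n%:R * d ^+ 2 / 8 by rewrite divr_gt0 // mulr_gt0 ?exprn_gt0.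
have h5 : Pr P B5 <= 64 / n%:R.
  apply: le_trans (Pr_chebyshev P01 (f := fun J => msize R J - p * (n%:R * (n%:R - 1) / 2))
    (t := n%:R * d ^+ 2 / 8) _ _) _ => //.
  rewrite ler_pdivrMr ?exprn_gt0 //.
  apply: le_trans (Ex_msize_deviation_le n p01) _.
  have -> : 64 / n%:R * (n%:R * d ^+ 2 / 8) ^+ 2 = n%:R * d ^+ 4 by field; rewrite gt_eqF.
  have -> : n%:R ^+ 2 * p = n%:R * d ^+ 2 by rewrite [in LHS]pE; field; rewrite gt_eqF.
  by [].
set s := Num.sqrt n%:R.
have s0 : 0 < s by rewrite sqrtr_gt0.
have sE : s ^+ 2 = n%:R by rewrite sqr_sqrtr // ltW.
have s1 : 1 <= s by rewrite -[1](sqrtr1 R) ler_sqrt //; lra.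
have ds : d <= s.
  rewrite -(ler_pXn2r (n := 2)) ?nnegrE ?(ltW d0) ?(ltW s0) // sE dE.
  by rewrite ler_piMr // ltW.
have sn : n%:R^-1 <= s^-1 by rewrite -sE lef_pV2 ?posrE ?exprn_gt0 // expr2 ler_peMr // ltW.
have dsn : d / n%:R <= s^-1.
  by rewrite ler_pdivrMr // -sE expr2 mulKf // gt_eqF.
rewrite lerD2l lerN2 -/P.
apply: le_trans (PrU P01 _ _) _.
have u2 := PrU P01 B2 (fun J => B3 J || (B4 J || B5 J)).
have u3 := PrU P01 B3 (fun J => B4 J || B5 J).
have u4 := PrU P01 B4 B5.
have t1 : 4 / eta ^+ 2 / n%:R <= 4 / eta ^+ 2 * s^-1 by rewrite ler_wpM2l // divr_ge0 // ltW // exprn_gt0.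
have t2 : 1 / eta ^+ 2 / n%:R <= 1 / eta ^+ 2 * s^-1 by rewrite ler_wpM2l // divr_ge0 // ltW // exprn_gt0.
have t3 : 12 / eta * (d / n%:R) <= 12 / eta * s^-1 by rewrite ler_wpM2l // divr_ge0 // ltW.
have t4 : 2 / eta * (d / n%:R) <= 2 / eta * s^-1 by rewrite ler_wpM2l // divr_ge0 // ltW.
have t5 : 64 / n%:R <= 64 * s^-1 by rewrite ler_wpM2l.
have -> : (5 / eta ^+ 2 + 14 / eta + 64) / s = 4 / eta ^+ 2 * s^-1 + 1 / eta ^+ 2 * s^-1 +
   12 / eta * s^-1 + 2 / eta * s^-1 + 64 * s^-1 by field; rewrite !gt_eqF.
rewrite -/P in u2 u3 u4.
lra.
Qed.

Lemma modularity_lower_whp (e : R) : 0 < e < 1 ->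
  exists2 a : R, 0 < a & forall p : nat -> R, (forall n, 0 <= p n <= 1) ->
    (\forall n \near \oo%classic, 1 <= n%:R * p n /\ p n <= 1 - e) ->
    gnp_whp p (fun n G => a / Num.sqrt (n%:R * p n) < modularity R G).
Proof.
case/andP => e0 e1.
pose c : R := Num.sqrt (e / 3) / (8 * (3 + 3 / e)).
have c0 : 0 < c.
  have : 0 < 3 / e by rewrite divr_gt0.
  by move=> h; rewrite divr_gt0 ?sqrtr_gt0 ?divr_gt0 // mulr_gt0 //; lra.
pose eta := c / 12.
have eta0 : 0 < eta by rewrite divr_gt0.
exists (c / 8) => [|p p01 hp]; first by rewrite divr_gt0.
apply: (whp_of_le_div_sqrt (C := 5 / eta ^+ 2 + 14 / eta + 64)) => //.
near=> n.
have [np1 pe] : 1 <= n%:R * p n /\ p n <= 1 - e by near: n.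
have n9 : (9 <= n)%N by near: n; exact: nbhs_infty_ge.
(* This ensures [d <= eta * n], because [d^2 = n p <= n]. *)
have eta_n : eta ^- 2 < n%:R by near: n; exact: nbhs_infty_gtr.
have N0 : 0 < n%:R :> R by rewrite ltr0n; lia.
set d := Num.sqrt (n%:R * p n).
have d1 : 1 <= d by rewrite -[1](sqrtr1 R) ler_sqrt //; lra.
have dE : d ^+ 2 = n%:R * p n by rewrite sqr_sqrtr //; lra.
apply: modularity_lower_prob => //.
- by lia.
- by rewrite /eta; lra.
- have d0 : 0 <= d by lra.
  have en0 : 0 <= eta * n%:R by apply: mulr_ge0; apply: ltW.
  rewrite -(ler_pXn2r (n := 2)) ?nnegrE //.
  rewrite dE exprMn [n%:R ^+ 2]expr2 mulrA mulrC ler_pM2r //.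
  have /andP[_ pn1] := p01 n; apply: le_trans pn1 _.
  by rewrite mulrC -ler_pdivrMr ?exprn_gt0 // mul1r ltW.
- by apply: Ex_gain_half_ge => //; rewrite e0 ltW.
Unshelve. all: by end_near.
Qed.

End LowerBound.

Theorem theorem1p3 (R : realType) :
  (exists b : R, forall p : nat -> R,
      (forall n, 0 < p n <= 1) ->
      gnp_whp p (fun n G => modularity R G < b / Num.sqrt (n%:R * p n)))
  /\
  (forall eps : R, 0 < eps < 1 ->
    exists2 a : R, 0 < a &
      forall p : nat -> R,
      (forall n, 0 <= p n <= 1) ->
      (\forall n \near \oo%classic, 1 <= n%:R * p n /\ p n <= 1 - eps) ->
      gnp_whp p (fun n G => a / Num.sqrt (n%:R * p n) < modularity R G)).
Proof.
split; first by exists 1000 => p; apply: modularity_upper_whp.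
exact: modularity_lower_whp.
Qed.
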